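(* Let $F, G$ be Schur functions of Szegő class, and let $\eta>0$ satisfy $\min(\eta(F),\eta(G))\ge \eta$. Then for every $r\in(0,1)$ and every integer $n\ge 0$, $$\|F_n-G_n\|_{L^2(r\mathbb{T})}\le C(\eta,r)\,r^{-n}\,\|F-G\|_{L^2(r\mathbb{T})},$$ where $$C(\eta,r)=\exp\left(\log\eta^{-1}\cdot\left(2+\frac{1}{1-\sqrt{1-\eta}}\right)\left(\frac{4}{(1-r)^2}+1\right)\right)$$ depends only on $\eta$ and $r$.
   Context: $\mathbb{D}=\{z\in\mathbb{C}:|z|<1\}$, $\mathbb{T}=\{z\in\mathbb{C}:|z|=1\}$, and $m$ is Lebesgue measure on $\mathbb{T}$ normalized by $m(\mathbb{T})=1$. The Schur class $\mathcal{S}(\mathbb{D})$ is the set of analytic functions $F$ in $\mathbb{D}$ with $\sup_{\mathbb{D}}|F|\le 1$; $\mathcal{S}_*(\mathbb{D})$ is the set of those $F\in\mathcal{S}(\mathbb{D})$ that are not finite Blaschke products (unimodular constants count as Blaschke products of order $0$). For $F\in\mathcal{S}_*(\mathbb{D})$ the Schur iterates $F_n\in\mathcal{S}_*(\mathbb{D})$, $n\ge0$, are defined by $F_0=F$ and $zF_{n+1}=\dfrac{F_n-F_n(0)}{1-\overline{F_n(0)}F_n}$; one has $|F_n(0)|<1$. Set $\eta(F)=\prod_{n=0}^\infty(1-|F_n(0)|^2)$. A function $F\in\mathcal{S}_*(\mathbb{D})$ is called a Schur function of Szegő class if $\eta(F)>0$. For $r\in(0,1)$ and $F$ analytic in $\mathbb{D}$,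 $\|F\|_{L^2(r\mathbb{T})}=\left(\int_{\mathbb{T}}|F(r\xi)|^2\,dm(\xi)\right)^{1/2}$. *)

(* Defs.v *)
From Stdlib Require Export Reals List.
From Coquelicot Require Export Coquelicot.
Open Scope R_scope.

(** Functions on the unit disk are total functions [C -> C]; only their values
    on [in_disk] are ever constrained or used. *)
Definition in_disk (z : C) : Prop := Cmod z < 1.

Definition analytic_at (F : C -> C) (z0 : C) : Prop :=
  exists (a : nat -> C) (rho : R), 0 < rho /\
    forall z : C, Cmod (z - z0) < rho ->
      is_pseries (K := C_AbsRing) (V := C_NormedModule) a (z - z0)%C (F z).

Definition schur_class (F : C -> C) : Prop :=
  (forall z, in_disk z -> analytic_at F z) /\
  (forall z, in_disk z -> Cmod (F z) <= 1).

(** The empty list of zeros gives the unimodular constants. *)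
Definition finite_blaschke (F : C -> C) : Prop :=
  exists (c : C) (zeros : list C),
    Cmod c = 1 /\ List.Forall in_disk zeros /\
    forall z, in_disk z ->
      F z = (c * fold_right Cmult (RtoC 1)
                   (map (fun a => (z - a) / (1 - Cconj a * z)) zeros))%C.

Definition schur_class_star (F : C -> C) : Prop :=
  schur_class F /\ ~ finite_blaschke F.

Definition schur_quotient (F : C -> C) (z : C) : C :=
  ((F z - F (RtoC 0)) / (1 - Cconj (F (RtoC 0)) * F z) / z)%C.

(** The singularity at [0] is removed by taking the limit.  [C_lim] computes it
    along the real axis and agrees with the complex limit whenever that limit
    exists ([is_C_lim_unique]), which is the case for [F] analytic at [0] with
    [Cmod (F 0) < 1]. *)
Definition schur_step (F : C -> C) (z : C) : C :=
  if Ceq_dec z (RtoC 0) then C_lim (schur_quotient F) (RtoC 0)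
  else schur_quotient F z.

Lemma schur_step_eq (F : C -> C) (z : C) :
  (z * schur_step F z =
   (F z - F (RtoC 0)) / (1 - Cconj (F (RtoC 0)) * F z))%C.
Proof.
  unfold schur_step, schur_quotient, Cdiv.
  destruct (Ceq_dec z (RtoC 0)) as [-> | Hz].
  - ring.
  - rewrite Cmult_comm, <- Cmult_assoc, Cinv_l, Cmult_1_r by exact Hz.
    reflexivity.
Qed.

Definition schur_iter (F : C -> C) (n : nat) : C -> C :=
  Nat.iter n schur_step F.

(** The partial products are non-increasing and lie in [[0, 1]] as soon as all
    [Cmod (schur_iter F n 0) <= 1], so [Lim_seq] is then a genuine finite
    limit. *)
Definition schur_eta (F : C -> C) : R :=
  real (Lim_seq (prod_f_R0
    (fun n => 1 - Cmod (schur_iter F n (RtoC 0)) ^ 2))).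

Definition szego_class (F : C -> C) : Prop :=
  schur_class_star F /\ 0 < schur_eta F.

(** Normalized Lebesgue measure on the unit circle is the image of
    [dt / (2 * PI)] on [[0, 2 * PI]] under [t |-> exp(i t)]; for [r < 1] the
    integrand is continuous when [F] is analytic in the disk. *)
Definition L2_norm (r : R) (F : C -> C) : R :=
  sqrt (/ (2 * PI) *
    RInt (fun t => Cmod (F (r * cos t, r * sin t)) ^ 2) 0 (2 * PI)).

Definition stability_const (eta r : R) : R :=
  exp (ln (/ eta) * (2 + 1 / (1 - sqrt (1 - eta)))
       * (4 / (1 - r) ^ 2 + 1)).

(* Main.v *)
Require Import Defs.
From Stdlib Require Import Reals Lra Lia Psatz ClassicalEpsilon.
From Coquelicot Require Import Coquelicot.
Open Scope R_scope.

(** Why the theorem is true.  Write [a = F_n(0)], [h = F_n - G_n], [h0 = h(0)]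
    and let [F'], [G'] be the next iterates.  The recursion
    [z F' (1 - conj a F_n) = F_n - a] and its analogue for [G] combine to
    [z (F' - G') (1 - conj a F_n)
       = (h - h0) + z G' (conj a h + conj h0 G_n)]
    ([schur_step_difference]).  On the circle of radius [r], the mean value
    property gives [||h - h0||^2 = ||h||^2 - |h0|^2], so that both [h - h0] and
    the constant [h0] have norm at most [||h||].  Since
    [|1 - conj a F_n| >= 1 - |a| >= 1 - sqrt (1 - eta) = 1 / K], one step reads
    [r ||F' - G'|| <= (1 + eps_n) ||h||], where [eps_n] is [K] times a sum of
    products of two of the numbers [|a|], [|F_n|], [|G_n|], [|G']|
    ([schur_step_stability]).  The linear term has been absorbed by [h - h0]:
    this is essential, because the Schur parameters are only square summable.

    It remains to sum [eps_n].  Put [A = ln (1 / eta)].  The product defining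
    [eta] gives [sum |F_k(0)|^2 <= A] ([schur_parameters_bounds]).  As
    [|F_n| <= |F_n(0)| + r |F_(n+1)|] on the circle, convexity of the square
    bounds [|F_n|^2] there by
    [q_n = 1 / (1 - r) * sum_k r^k |F_(n+k)(0)|^2]
    ([schur_iter_majorant]), and [sum q_n <= A / (1 - r)^2]
    ([tail_majorant_sum]).  So [sum eps_n <= K A (1 + 2 / (1 - r)^2)], which is
    below the exponent of [stability_const].

    The complex analysis behind this consists of two facts: the mean value
    property on centered circles ([mean_value_Re]) and the Schwarz lemma, which
    keeps the iterates bounded by one ([schur_step_bound]).  A Schur step is a
    Moebius map followed by a division by [z], so analyticity is traded for the
    property [smooth_at N] for all [N], a finite Taylor expansion with Lipschitz
    remainder, which is visibly stable under these operations and still yields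
    the mean value property. *)

(** * Finite Taylor expansions at a point *)

Definition near (z0 : C) (P : C -> Prop) : Prop :=
  exists d, 0 < d /\ forall z, Cmod (z - z0) < d -> P z.

Lemma near_and z0 P Q : near z0 P -> near z0 Q -> near z0 (fun z => P z /\ Q z).
Proof.
  intros [d [Hd HP]] [e [He HQ]].
  exists (Rmin d e); split; [now apply Rmin_glb_lt|].
  intros z Hz; split; [apply HP | apply HQ];
    (eapply Rlt_le_trans; [exact Hz|]); [apply Rmin_l | apply Rmin_r].
Qed.

Lemma near_imp z0 (P Q : C -> Prop) :
  (forall z, P z -> Q z) -> near z0 P -> near z0 Q.
Proof. intros H [d [Hd HP]]; exists d; split; auto. Qed.

Lemma Cmod_sub_self z : Cmod (z - z) = 0.
Proof. replace (z - z)%C with (RtoC 0) by ring. apply Cmod_0. Qed.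

Lemma near_center z0 P : near z0 P -> P z0.
Proof. intros [d [Hd H]]; apply H. now rewrite Cmod_sub_self. Qed.

Definition lipschitz_at (F : C -> C) (z0 : C) : Prop :=
  exists L d, 0 <= L /\ 0 < d /\
    forall w v, Cmod (w - z0) < d -> Cmod (v - z0) < d ->
      Cmod (F w - F v) <= L * Cmod (w - v).

(** Taylor expansion of order [N] at [z0] whose last coefficient function is
    Lipschitz.  Each level peels off one factor [z - z0], so dividing out a zero
    just lowers the order by one. *)
Fixpoint smooth_at (N : nat) (F : C -> C) (z0 : C) : Prop :=
  match N with
  | O => lipschitz_at F z0
  | S N => exists G, smooth_at N G z0 /\
      near z0 (fun z => F z = F z0 + (z - z0) * G z)%C
  end.

Lemma lipschitz_near F z0 eps :
  lipschitz_at F z0 -> 0 < eps -> near z0 (fun z => Cmod (F z - F z0) < eps).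
Proof.
  intros (L & d & HL & Hd & H) He.
  exists (Rmin d (eps / (L + 1))); split.
  { apply Rmin_glb_lt; auto. apply Rdiv_lt_0_compat; lra. }
  intros z Hz.
  assert (H1 : Cmod (z - z0) < d) by (eapply Rlt_le_trans; [exact Hz | apply Rmin_l]).
  assert (H2 : Cmod (z - z0) < eps / (L + 1)) by (eapply Rlt_le_trans; [exact Hz | apply Rmin_r]).
  assert (H3 : Cmod (F z - F z0) <= L * Cmod (z - z0)).
  { apply H; auto. now rewrite Cmod_sub_self. }
  pose proof (Cmod_ge_0 (z - z0)).
  assert (H4 : (L + 1) * Cmod (z - z0) < (L + 1) * (eps / (L + 1)))
    by (apply Rmult_lt_compat_l; lra).
  replace ((L + 1) * (eps / (L + 1))) with eps in H4 by (field; lra).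
  nra.
Qed.

Lemma Cmod_sub_triangle a b : Cmod a <= Cmod b + Cmod (a - b).
Proof.
  replace a with (b + (a - b))%C at 1 by ring. apply Cmod_triangle.
Qed.

Lemma Cmod_sub_sym a b : Cmod (a - b) = Cmod (b - a).
Proof. rewrite <- Cmod_opp. f_equal. ring. Qed.

Lemma lipschitz_bounded F z0 :
  lipschitz_at F z0 -> near z0 (fun z => Cmod (F z) <= Cmod (F z0) + 1).
Proof.
  intros H. eapply near_imp; [|apply (lipschitz_near F z0 1 H); lra].
  intros z Hz. pose proof (Cmod_sub_triangle (F z) (F z0)). simpl in *. lra.
Qed.

Lemma lipschitz_of_near z0 (P : C -> Prop) (F : C -> C) (L : R) :
  0 <= L -> near z0 P ->
  (forall w v, P w -> P v -> Cmod (F w - F v) <= L * Cmod (w - v)) ->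
  lipschitz_at F z0.
Proof.
  intros HL [d [Hd H]] HF. exists L, d; repeat split; auto.
Qed.

Lemma near_ball z0 d : 0 < d -> near z0 (fun z => Cmod (z - z0) < d).
Proof. intros; exists d; auto. Qed.

Lemma lipschitz_ext F G z0 :
  near z0 (fun z => F z = G z) -> lipschitz_at F z0 -> lipschitz_at G z0.
Proof.
  intros HE (L & d & HL & Hd & H).
  apply (lipschitz_of_near z0 _ _ L HL (near_and _ _ _ HE (near_ball z0 d Hd))).
  intros w v [E1 ?] [E2 ?]. rewrite <- E1, <- E2. auto.
Qed.

Lemma lipschitz_const c z0 : lipschitz_at (fun _ => c) z0.
Proof.
  exists 0, 1; repeat split; try lra. intros.
  rewrite Cmod_sub_self. lra.
Qed.

Lemma lipschitz_id z0 : lipschitz_at (fun z => z) z0.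
Proof. exists 1, 1; repeat split; intros; lra. Qed.

Lemma lipschitz_add F G z0 :
  lipschitz_at F z0 -> lipschitz_at G z0 -> lipschitz_at (fun z => F z + G z)%C z0.
Proof.
  intros (L & d & HL & Hd & H) (M & e & HM & He & K).
  apply (lipschitz_of_near z0 _ _ (L + M) ltac:(lra)
           (near_and _ _ _ (near_ball z0 d Hd) (near_ball z0 e He))).
  intros w v [H1 H2] [H3 H4].
  replace (F w + G w - (F v + G v))%C with ((F w - F v) + (G w - G v))%C by ring.
  eapply Rle_trans; [apply Cmod_triangle|].
  specialize (H w v H1 H3); specialize (K w v H2 H4). lra.
Qed.

(** [F w G w - F v G v = F w (G w - G v) + G v (F w - F v)], and both functions
    are bounded near [z0]. *)
Lemma lipschitz_mul F G z0 :
  lipschitz_at F z0 -> lipschitz_at G z0 -> lipschitz_at (fun z => F z * G z)%C z0.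
Proof.
  intros HF HG.
  pose proof (lipschitz_bounded _ _ HF) as BF.
  pose proof (lipschitz_bounded _ _ HG) as BG.
  destruct HF as (L & d & HL & Hd & H). destruct HG as (M & e & HM & He & K).
  set (f := Cmod (F z0) + 1) in *. set (g := Cmod (G z0) + 1) in *.
  assert (0 <= f) by (unfold f; pose proof (Cmod_ge_0 (F z0)); lra).
  assert (0 <= g) by (unfold g; pose proof (Cmod_ge_0 (G z0)); lra).
  apply (lipschitz_of_near z0 _ _ (f * M + g * L) ltac:(nra)
     (near_and _ _ _ (near_and _ _ _ BF BG)
           (near_and _ _ _ (near_ball z0 d Hd) (near_ball z0 e He)))).
  intros w v [[B1 B2] [W1 W2]] [[B3 B4] [V1 V2]]. simpl in *.
  replace (F w * G w - F v * G v)%C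
    with (F w * (G w - G v) + G v * (F w - F v))%C by ring.
  eapply Rle_trans; [apply Cmod_triangle|]. rewrite !Cmod_mult.
  specialize (H w v W1 V1); specialize (K w v W2 V2).
  rewrite Rmult_plus_distr_r, !Rmult_assoc.
  apply Rplus_le_compat; apply Rmult_le_compat; auto using Cmod_ge_0.
Qed.

Lemma lipschitz_inv F z0 :
  F z0 <> RtoC 0 -> lipschitz_at F z0 -> lipschitz_at (fun z => / F z)%C z0.
Proof.
  intros H0 HF. apply Cmod_gt_0 in H0. set (f := Cmod (F z0)) in *.
  pose proof (lipschitz_near F z0 (f / 2) HF ltac:(lra)) as B.
  destruct HF as (L & d & HL & Hd & H).
  assert (P : 0 < (f / 2) * (f / 2)) by (apply Rmult_lt_0_compat; lra).
  apply (lipschitz_of_near z0 _ _ (L / ((f / 2) * (f / 2)))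
     ltac:(apply Rle_mult_inv_pos; lra)
     (near_and _ _ _ B (near_ball z0 d Hd))).
  assert (A : forall z, Cmod (F z - F z0) < f / 2 -> f / 2 <= Cmod (F z)).
  { intros z Hz. pose proof (Cmod_sub_triangle (F z0) (F z)).
    rewrite Cmod_sub_sym in Hz. unfold f in *. lra. }
  intros w v [B1 H1] [B2 H2]. apply A in B1. apply A in B2.
  assert (F w <> RtoC 0) by (apply Cmod_gt_0; lra).
  assert (F v <> RtoC 0) by (apply Cmod_gt_0; lra).
  replace (/ F w - / F v)%C with ((F v - F w) / (F w * F v))%C by (field; auto).
  rewrite Cmod_div by (apply Cmult_neq_0; auto).
  rewrite Cmod_mult, Cmod_sub_sym. unfold Rdiv at 1.
  replace (L / (f / 2 * (f / 2)) * Cmod (w - v))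
    with ((L * Cmod (w - v)) * / (f / 2 * (f / 2))) by (unfold Rdiv; ring).
  apply Rmult_le_compat; auto using Cmod_ge_0.
  - apply Rlt_le, Rinv_0_lt_compat. nra.
  - apply Rinv_le_contravar; auto. apply Rmult_le_compat; lra.
Qed.

Lemma near_comp phi z0 P :
  lipschitz_at phi z0 -> near (phi z0) P -> near z0 (fun z => P (phi z)).
Proof.
  intros H [d [Hd HP]]. eapply near_imp; [|apply (lipschitz_near phi z0 d H Hd)].
  intros z Hz; auto.
Qed.

Lemma lipschitz_comp F phi z0 :
  lipschitz_at F (phi z0) -> lipschitz_at phi z0 ->
  lipschitz_at (fun z => F (phi z)) z0.
Proof.
  intros (L & d & HL & Hd & H) Hphi.
  pose proof (near_comp phi z0 _ Hphi (near_ball (phi z0) d Hd)) as B.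
  destruct Hphi as (M & e & HM & He & K).
  apply (lipschitz_of_near z0 _ _ (L * M) ltac:(nra)
     (near_and _ _ _ B (near_ball z0 e He))).
  intros w v [B1 H1] [B2 H2].
  eapply Rle_trans; [apply H; auto|]. rewrite Rmult_assoc.
  apply Rmult_le_compat_l; auto.
Qed.

Lemma smooth_lipschitz N F z0 : smooth_at N F z0 -> lipschitz_at F z0.
Proof.
  revert F; induction N as [|N IH]; intros F; [easy|].
  intros (G & HG & E). apply IH in HG.
  apply (lipschitz_ext (fun z => F z0 + (z + (- z0)) * G z)%C).
  { eapply near_imp; [|exact E]. intros z ->. reflexivity. }
  apply lipschitz_add; [apply lipschitz_const|].
  apply lipschitz_mul; auto.
  apply lipschitz_add; [apply lipschitz_id | apply lipschitz_const].
Qed.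

Lemma smooth_pred N F z0 : smooth_at (S N) F z0 -> smooth_at N F z0.
Proof.
  revert F; induction N as [|N IH]; intros F H.
  - exact (smooth_lipschitz 1 F z0 H).
  - destruct H as (G & HG & E). exists G; split; auto.
Qed.

Lemma smooth_ext N F G z0 :
  near z0 (fun z => F z = G z) -> smooth_at N F z0 -> smooth_at N G z0.
Proof.
  destruct N as [|N]; [apply lipschitz_ext|].
  intros HE (K & HK & E). exists K; split; auto.
  pose proof (near_center _ _ HE) as E0. simpl in E0.
  eapply near_imp; [|exact (near_and _ _ _ HE E)].
  intros z [<- E1]. now rewrite <- E0.
Qed.

Lemma smooth_const N c z0 : smooth_at N (fun _ => c) z0.
Proof.
  revert c; induction N as [|N IH]; intros c; [apply lipschitz_const|].
  exists (fun _ => RtoC 0); split; auto.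
  exists 1; split; [lra|]. intros. ring.
Qed.

Lemma smooth_id N z0 : smooth_at N (fun z => z) z0.
Proof.
  destruct N; [apply lipschitz_id|].
  exists (fun _ => RtoC 1); split; [apply smooth_const|].
  exists 1; split; [lra|]. intros. ring.
Qed.

Lemma smooth_add N F G z0 :
  smooth_at N F z0 -> smooth_at N G z0 -> smooth_at N (fun z => F z + G z)%C z0.
Proof.
  revert F G; induction N as [|N IH]; intros F G; [apply lipschitz_add|].
  intros (F1 & HF & EF) (G1 & HG & EG).
  exists (fun z => F1 z + G1 z)%C; split; auto.
  eapply near_imp; [|exact (near_and _ _ _ EF EG)].
  intros z [E1 E2]. rewrite E1, E2 at 1. ring.
Qed.

(** [F G = F(z0) G(z0) + (z - z0) (F1 G + F(z0) G1)]: the induction uses order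
    [N] of [G] itself next to order [N] of the quotients. *)
Lemma smooth_mul N F G z0 :
  smooth_at N F z0 -> smooth_at N G z0 -> smooth_at N (fun z => F z * G z)%C z0.
Proof.
  revert F G; induction N as [|N IH]; intros F G; [apply lipschitz_mul|].
  intros (F1 & HF & EF) SG. pose proof (smooth_pred _ _ _ SG) as SG'.
  destruct SG as (G1 & HG & EG).
  exists (fun z => F1 z * G z + F z0 * G1 z)%C; split.
  - apply smooth_add; [now apply IH|]. apply (IH (fun _ => F z0)); auto.
    apply smooth_const.
  - eapply near_imp; [|exact (near_and _ _ _ EF EG)].
    intros z [E1 E2]. rewrite E1, E2. ring.
Qed.

(** [1 / F - 1 / F(z0) = - (z - z0) F1 / (F(z0) F)], so order [N + 1] of [1 / F]
    only needs order [N] of [1 / F] and of [F1]. *)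
Lemma smooth_inv N F z0 :
  F z0 <> RtoC 0 -> smooth_at N F z0 -> smooth_at N (fun z => / F z)%C z0.
Proof.
  intros H0. induction N as [|N IH]; [now apply lipschitz_inv|].
  intros SF. pose proof (smooth_lipschitz _ _ _ SF) as LF.
  pose proof (smooth_pred _ _ _ SF) as SF'. destruct SF as (F1 & HF & EF).
  exists (fun z => (- / F z0) * (F1 z * / F z))%C; split.
  - apply (smooth_mul N (fun _ => - / F z0)%C); [apply smooth_const|].
    apply smooth_mul; auto.
  - assert (P : 0 < Cmod (F z0)) by now apply Cmod_gt_0.
    eapply near_imp; [|exact (near_and _ _ _ EF (lipschitz_near F z0 _ LF P))].
    intros z [E1 E2].
    assert (F z <> RtoC 0).
    { intros E. rewrite E, Cmod_sub_sym in E2. replace (F z0 - 0)%C with (F z0) in E2 by ring. lra. }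
    replace ((z - z0) * (- / F z0 * (F1 z * / F z)))%C
      with (- (F z - F z0) * / F z0 * / F z)%C by (rewrite E1; field; rewrite <- E1; auto).
    field. auto.
Qed.

(** Substituting the expansion of [phi] into that of [F] leaves the quotient
    [psi * (F1 o phi)], of one order less. *)
Lemma smooth_comp N F phi z0 :
  smooth_at N F (phi z0) -> smooth_at N phi z0 ->
  smooth_at N (fun z => F (phi z)) z0.
Proof.
  revert F; induction N as [|N IH]; intros F; [apply lipschitz_comp|].
  intros (F1 & HF & EF) SP. pose proof (smooth_lipschitz _ _ _ SP) as LP.
  pose proof (smooth_pred _ _ _ SP) as SP'. destruct SP as (psi & HP & EP).
  exists (fun z => psi z * F1 (phi z))%C; split.
  - apply smooth_mul; auto.
  - eapply near_imp; [|exact (near_and _ _ _ EP (near_comp _ _ _ LP EF))].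
    intros z [E1 E2]. rewrite E2. rewrite E1 at 1. ring.
Qed.

(** * Power series have Taylor expansions of all orders *)

(** Induction on [w^(k+1) - v^(k+1) = w (w^k - v^k) + (w - v) v^k]. *)
Lemma Cpow_diff_bound (w v : C) (s : R) (k : nat) :
  Cmod w <= s -> Cmod v <= s ->
  Cmod (w ^ S k - v ^ S k) <= INR (S k) * s ^ k * Cmod (w - v).
Proof.
  intros Hw Hv. assert (Hs : 0 <= s) by (pose proof (Cmod_ge_0 w); lra).
  induction k as [|k IH].
  - simpl. replace (w * 1 - v * 1)%C with (w - v)%C by ring. lra.
  - replace (w ^ S (S k) - v ^ S (S k))%C
      with (w * (w ^ S k - v ^ S k) + (w - v) * v ^ S k)%C by (simpl; ring).
    eapply Rle_trans; [apply Cmod_triangle|].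
    rewrite !Cmod_mult, Cmod_pow, (S_INR (S k)).
    pose proof (Cmod_ge_0 (w - v)) as Hd.
    assert (H1 : Cmod w * Cmod (w ^ S k - v ^ S k)
              <= s * (INR (S k) * s ^ k * Cmod (w - v)))
      by (apply Rmult_le_compat; auto using Cmod_ge_0).
    assert (H2 : Cmod v ^ S k <= s ^ S k)
      by (apply pow_incr; split; auto using Cmod_ge_0).
    assert (H3 : Cmod (w - v) * Cmod v ^ S k <= Cmod (w - v) * s ^ S k)
      by (apply Rmult_le_compat_l; auto).
    simpl pow in *. lra.
Qed.

Lemma sum_half_powers_le (n : nat) :
  sum_f_R0 (fun k => INR (S k) * (/ 2) ^ k) n <= 4.
Proof.
  enough (E : sum_f_R0 (fun k => INR (S k) * (/ 2) ^ k) n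
          = 4 - (INR n + 3) * (/ 2) ^ n).
  { rewrite E. pose proof (pos_INR n). pose proof (pow_lt (/ 2) n ltac:(lra)). nra. }
  induction n as [|n IH]; [simpl; lra|].
  rewrite tech5, IH, !S_INR. simpl pow. field.
Qed.

Lemma pow_n_C (w : C) n : pow_n (K := C_AbsRing) w n = (w ^ n)%C.
Proof.
  induction n as [|n IH]; [reflexivity|]. simpl. now rewrite IH.
Qed.

Lemma sum_n_C_bound (f : nat -> C_NormedModule) (g : nat -> R) n :
  (forall k, (k <= n)%nat -> Cmod (f k) <= g k) ->
  Cmod (sum_n (G := C_NormedModule) f n) <= sum_f_R0 g n.
Proof.
  induction n as [|n IH]; intros H.
  - rewrite sum_O. simpl. apply H; lia.
  - rewrite sum_Sn, tech5.
    eapply Rle_trans; [apply Cmod_triangle|].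
    apply Rplus_le_compat; [apply IH; intros; apply H; lia | apply H; lia].
Qed.

Lemma norm_C (x : C) : norm (K := C_AbsRing) (V := C_NormedModule) x = Cmod x.
Proof. reflexivity. Qed.

Lemma is_series_C_bound (f : nat -> C_NormedModule) (l : C) (B : R) :
  is_series (V := C_NormedModule) f l ->
  (forall n, Cmod (sum_n (G := C_NormedModule) f n) <= B) -> Cmod l <= B.
Proof.
  intros H HB.
  pose proof (filterlim_comp _ _ _ _ _ _ _ _ H (filterlim_norm (V := C_NormedModule) l)) as L.
  rewrite <- norm_C.
  change (Rbar_le (norm (l : C_NormedModule)) B).
  apply (is_lim_seq_le (fun n => norm (sum_n f n)) (fun _ => B)); [|exact L | apply is_lim_seq_const].
  intros n. rewrite norm_C. apply HB.
Qed.

Lemma is_series_C_terms_bounded (f : nat -> C_NormedModule) (l : C) :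
  is_series (V := C_NormedModule) f l -> exists M, forall n, Cmod (f n) <= M.
Proof.
  intros H.
  assert (L : is_lim_seq (fun n => norm (sum_n f n)) (norm (l : C_NormedModule))).
  { exact (filterlim_comp _ _ _ _ _ _ _ _ H (filterlim_norm (V := C_NormedModule) l)). }
  destruct (filterlim_bounded (fun n => norm (sum_n f n)))  as [M HM].
  { exists (norm (l : C_NormedModule)). exact L. }
  exists (M + M). intros n.
  assert (A : forall n, Cmod (sum_n f n) <= M).
  { intros k. rewrite <- norm_C. specialize (HM k).
    eapply Rle_trans; [|exact HM].
    exact (Rle_abs (norm (sum_n f k))). }
  destruct n as [|n].
  - specialize (A 0%nat). rewrite sum_O in A. pose proof (Cmod_ge_0 (f 0%nat)). lra.
  - replace (f (S n)) with (sum_n f (S n) - sum_n f n)%C.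
    2:{ rewrite sum_Sn. change plus with Cplus. ring. }
    unfold Cminus. eapply Rle_trans; [apply Cmod_triangle|].
    rewrite Cmod_opp. apply Rplus_le_compat; auto.
Qed.

(** Convergence at distance [rho / 2] bounds [|a_k| (rho / 2)^k] by some [M]; on
    the disk of radius [rho / 4] the difference of the terms of order [k] is then
    dominated by [|w - v|] times a multiple of [k / 2^k], which is summable. *)
Lemma analytic_lipschitz F z0 : analytic_at F z0 -> lipschitz_at F z0.
Proof.
  intros (a & rho & Hr & H).
  assert (Hm : Cmod (z0 + RtoC (rho / 2) - z0) < rho).
  { replace (z0 + RtoC (rho / 2) - z0)%C with (RtoC (rho / 2)) by ring.
    rewrite Cmod_R, Rabs_pos_eq; lra. }
  destruct (is_series_C_terms_bounded _ _ (H _ Hm)) as [M HM].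
  assert (HM' : forall n, Cmod (a n) * (rho / 2) ^ n <= M).
  { intros n. specialize (HM n). rewrite pow_n_C in HM.
    replace (z0 + RtoC (rho / 2) - z0)%C with (RtoC (rho / 2)) in HM by ring.
    change scal with Cmult in HM. rewrite Cmod_mult, Cmod_pow, Cmod_R, Rabs_pos_eq in HM; lra. }
  assert (HM0 : 0 <= M).
  { specialize (HM' 0%nat). simpl in HM'. pose proof (Cmod_ge_0 (a 0%nat)). lra. }
  apply (lipschitz_of_near z0 _ F (4 * (2 / rho * M))
    ltac:(apply Rmult_le_pos; [lra|]; apply Rmult_le_pos; auto; apply Rlt_le, Rdiv_lt_0_compat; lra)
    (near_ball z0 (rho / 4) ltac:(lra))).
  intros w v Hw Hv.
  pose proof (is_series_minus _ _ _ _ (H w ltac:(lra)) (H v ltac:(lra))) as HS.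
  apply (is_series_C_bound _ _ _ HS).
  intros n. pose proof (Cmod_ge_0 (w - v)) as Hd.
  assert (Hc : 0 <= 2 / rho * M) by (apply Rmult_le_pos; auto; apply Rlt_le, Rdiv_lt_0_compat; lra).
  assert (T : forall k, Cmod (scal (pow_n (K := C_AbsRing) (w - z0)%C k) (a k)
                  - scal (pow_n (K := C_AbsRing) (v - z0)%C k) (a k))
            <= match k with O => 0 | S k => INR (S k) * (/ 2) ^ k * (2 / rho * M * Cmod (w - v)) end).
  { intros k. rewrite (pow_n_C (w - z0)), (pow_n_C (v - z0)). change scal with Cmult.
    replace ((w - z0) ^ k * a k - (v - z0) ^ k * a k)%C
      with (((w - z0) ^ k - (v - z0) ^ k) * a k)%C by ring.
    destruct k as [|k].
    - replace (((w - z0) ^ 0 - (v - z0) ^ 0) * a 0%nat)%C with (RtoC 0) by (simpl; ring).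
      rewrite Cmod_0; lra.
    - rewrite Cmod_mult.
      assert (H1 := Cpow_diff_bound (w - z0) (v - z0) (rho / 4) k ltac:(lra) ltac:(lra)).
      replace (w - z0 - (v - z0))%C with (w - v)%C in H1 by ring.
      specialize (HM' (S k)).
      assert (E : rho / 4 = / 2 * (rho / 2)) by field.
      eapply Rle_trans.
      { apply Rmult_le_compat_r; [apply Cmod_ge_0 | exact H1]. }
      rewrite E, Rpow_mult_distr.
      pose proof (pow_lt (/ 2) k ltac:(lra)). pose proof (pos_INR (S k)).
      replace (INR (S k) * ((/ 2) ^ k * (rho / 2) ^ k) * Cmod (w - v) * Cmod (a (S k)))
        with (INR (S k) * (/ 2) ^ k * (2 / rho * (Cmod (a (S k)) * (rho / 2) ^ S k) * Cmod (w - v)))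
        by (simpl pow; field; lra).
      apply Rmult_le_compat_l; [nra|]. apply Rmult_le_compat_r; auto.
      apply Rmult_le_compat_l; auto. apply Rlt_le, Rdiv_lt_0_compat; lra. }
  eapply Rle_trans; [apply sum_n_C_bound; intros k _; exact (T k)|].
  destruct n as [|n]; [simpl; nra|].
  rewrite decomp_sum by lia. simpl pred.
  rewrite <- scal_sum. pose proof (sum_half_powers_le n).
  replace (4 * (2 / rho * M) * Cmod (w - v)) with ((2 / rho * M * Cmod (w - v)) * 4) by ring.
  rewrite Rplus_0_l. apply Rmult_le_compat_l; nra.
Qed.

(** The quotient is given by the shifted power series, so it is analytic again;
    this makes [analytic_smooth] an induction on the order. *)
Lemma analytic_factor F z0 :
  analytic_at F z0 -> exists G, analytic_at G z0 /\
    near z0 (fun z => F z = F z0 + (z - z0) * G z)%C.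
Proof.
  intros (a & rho & Hr & H).
  assert (E0 : F z0 = a 0%nat).
  { assert (H0 := H z0 ltac:(now rewrite Cmod_sub_self)).
    replace (z0 - z0)%C with (RtoC 0) in H0 by ring.
    refine (filterlim_locally_unique (V := C_NormedModule) _ _ _ H0 _).
    exact (is_pseries_0 (K := C_AbsRing) (V := C_NormedModule) a). }
  exists (fun z => if Ceq_dec z z0 then a 1%nat else (F z - F z0) / (z - z0))%C.
  split.
  - exists (PS_decr_1 a), rho; split; auto. intros z Hz.
    destruct (Ceq_dec z z0) as [-> | Hn].
    + replace (z0 - z0)%C with (RtoC 0) by ring.
      exact (is_pseries_0 (K := C_AbsRing) (V := C_NormedModule) (PS_decr_1 a)).
    + assert (Hz0 : (z - z0)%C <> RtoC 0).
      { intros E. apply Hn. replace z with (z - z0 + z0)%C by ring. rewrite E. ring. }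
      pose proof (is_pseries_decr_1 (K := C_AbsRing) (V := C_NormedModule) a (z - z0)%C (/ (z - z0))%C (F z)
         (Cinv_l _ Hz0) (H z Hz)) as P.
      rewrite E0. unfold Cdiv. rewrite Cmult_comm. exact P.
  - exists 1; split; [lra|]. intros z _.
    destruct (Ceq_dec z z0) as [-> | Hn]; [ring|].
    field. intros E. apply Hn. replace z with (z - z0 + z0)%C by ring. rewrite E. ring.
Qed.

Lemma analytic_smooth N F z0 : analytic_at F z0 -> smooth_at N F z0.
Proof.
  revert F; induction N as [|N IH]; intros F H; [now apply analytic_lipschitz|].
  destruct (analytic_factor F z0 H) as (G & HG & E). exists G; auto.
Qed.

(** * The mean value property *)

(** Strict differentiability, with quadratic error: since both
    points vary, the derivative is automatically continuous. *)
Definition strict_deriv (F : C -> C) (z0 D : C) : Prop :=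
  exists L d, 0 <= L /\ 0 < d /\
    forall w v, Cmod (w - z0) < d -> Cmod (v - z0) < d ->
      Cmod (F w - F v - (w - v) * D)
        <= L * Cmod (w - v) * (Cmod (w - z0) + Cmod (v - z0)).

(** [F w - F v - (w - v) G(z0) = (w - v) (G w - G(z0)) + (v - z0) (G w - G v)]. *)
Lemma smooth_strict_deriv F z0 : smooth_at 1 F z0 -> exists D, strict_deriv F z0 D.
Proof.
  intros (G & (L & d & HL & Hd & H) & (e & He & HE)).
  exists (G z0), L, (Rmin d e); repeat split; auto.
  { now apply Rmin_glb_lt. }
  intros w v Hw Hv.
  pose proof (Rmin_l d e); pose proof (Rmin_r d e).
  rewrite (HE w) by lra. rewrite (HE v) by lra.
  replace (F z0 + (w - z0) * G w - (F z0 + (v - z0) * G v) - (w - v) * G z0)%C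
    with ((w - v) * (G w - G z0) + (v - z0) * (G w - G v))%C by ring.
  eapply Rle_trans; [apply Cmod_triangle|]. rewrite !Cmod_mult.
  assert (T1 : Cmod (G w - G z0) <= L * Cmod (w - z0))
    by (apply H; [lra | rewrite Cmod_sub_self; lra]).
  assert (T2 : Cmod (G w - G v) <= L * Cmod (w - v)) by (apply H; lra).
  pose proof (Cmod_ge_0 (w - v)); pose proof (Cmod_ge_0 (v - z0)).
  apply (Rmult_le_compat_l (Cmod (w - v))) in T1; auto.
  apply (Rmult_le_compat_l (Cmod (v - z0))) in T2; auto.
  lra.
Qed.

Lemma strict_deriv_scal F z0 D c :
  strict_deriv F z0 D -> strict_deriv (fun z => c * F z)%C z0 (c * D)%C.
Proof.
  intros (L & d & HL & Hd & H).
  exists (Cmod c * L), d; repeat split; auto.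
  { apply Rmult_le_pos; auto using Cmod_ge_0. }
  intros w v Hw Hv.
  replace (c * F w - c * F v - (w - v) * (c * D))%C
    with (c * (F w - F v - (w - v) * D))%C by ring.
  rewrite Cmod_mult, !Rmult_assoc. apply Rmult_le_compat_l; auto using Cmod_ge_0.
  rewrite <- Rmult_assoc. auto.
Qed.

Lemma Rle_of_small_perturbation a b K h0 :
  0 < h0 -> 0 <= K -> (forall h, 0 < h -> h < h0 -> a <= b + K * h) -> a <= b.
Proof.
  intros Hh HK H. apply le_epsilon. intros e He.
  set (h := Rmin (h0 / 2) (e / (K + 1))).
  assert (0 < h) by (apply Rmin_glb_lt; [lra | apply Rdiv_lt_0_compat; lra]).
  assert (h <= h0 / 2) by apply Rmin_l.
  assert (H3 : h <= e / (K + 1)) by apply Rmin_r.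
  specialize (H h ltac:(auto) ltac:(lra)).
  apply (Rmult_le_compat_l (K + 1)) in H3; [|lra].
  replace ((K + 1) * (e / (K + 1))) with e in H3 by (field; lra). lra.
Qed.

(** Compare the expansions at [z0] and at [z] on the pair [z + h], [z], divide by
    [h] and let [h] tend to [0]. *)
Lemma strict_deriv_lipschitz F z0 D0 :
  strict_deriv F z0 D0 ->
  exists L, 0 <= L /\
    near z0 (fun z => forall D, strict_deriv F z D -> Cmod (D - D0) <= L * Cmod (z - z0)).
Proof.
  intros (L & d & HL & Hd & H). exists (2 * L); split; [lra|].
  exists (d / 2); split; [lra|]. intros z Hz D (L' & d' & HL' & Hd' & H').
  apply (Rle_of_small_perturbation _ _ (L + L') (Rmin (d / 2) d')); [apply Rmin_glb_lt; lra | lra |].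
  intros h Hh Hh'.
  pose proof (Rmin_l (d / 2) d'); pose proof (Rmin_r (d / 2) d').
  assert (Eh : Cmod (RtoC h) = h) by (rewrite Cmod_R, Rabs_pos_eq; lra).
  assert (A1 : Cmod (z + RtoC h - z0) <= Cmod (z - z0) + h).
  { replace (z + RtoC h - z0)%C with ((z - z0) + RtoC h)%C by ring.
    rewrite <- Eh at 2. apply Cmod_triangle. }
  assert (A2 : (z + RtoC h - z)%C = RtoC h) by ring.
  specialize (H (z + RtoC h)%C z ltac:(lra) ltac:(lra)).
  specialize (H' (z + RtoC h)%C z ltac:(rewrite A2; lra) ltac:(rewrite Cmod_sub_self; lra)).
  rewrite A2 in *. rewrite Cmod_sub_self in H'. rewrite Eh in *.
  assert (T : h * Cmod (D - D0) <= h * (2 * L * Cmod (z - z0) + (L + L') * h)).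
  { rewrite <- Eh at 1. rewrite <- Cmod_mult.
    replace (h * (D - D0))%C
      with ((F (z + h)%C - F z - h * D0) + - (F (z + h)%C - F z - h * D))%C by ring.
    eapply Rle_trans; [apply Cmod_triangle|]. rewrite Cmod_opp.
    pose proof (Cmod_ge_0 (z - z0)). 
    assert (L * h * (Cmod (z + h - z0) + Cmod (z - z0)) <= L * h * (Cmod (z - z0) + h + Cmod (z - z0))).
    { apply Rmult_le_compat_l; [apply Rmult_le_pos; lra | lra]. }
    nra. }
  now apply Rmult_le_reg_l in T.
Qed.

Lemma near_locally z0 P : near z0 P -> locally (T := C_UniformSpace) z0 P.
Proof.
  intros (d & Hd & H).
  assert (Hs : 0 < sqrt 2) by (apply sqrt_lt_R0; lra).
  assert (He : 0 < d / sqrt 2) by now apply Rdiv_lt_0_compat.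
  exists (mkposreal _ He). intros y Hy. apply H.
  pose proof (C_NormedModule_mixin_compat2 _ _ _ Hy) as K. simpl in K.
  replace (sqrt 2 * (d / sqrt 2)) with d in K by (field; lra). exact K.
Qed.

Lemma continuous_near (f : C -> R) z0 :
  (forall eps, 0 < eps -> near z0 (fun z => Rabs (f z - f z0) < eps)) ->
  continuous (T := C_UniformSpace) (U := R_UniformSpace) f z0.
Proof.
  intros H P [eps HP]. unfold filtermap.
  generalize (near_locally _ _ (H eps (cond_pos eps))). apply filter_imp.
  intros z Hz. apply HP. exact Hz.
Qed.

Lemma Cmod_le_2Rmax w : Cmod w <= 2 * Rmax (Rabs (fst w)) (Rabs (snd w)).
Proof.
  eapply Rle_trans; [apply Cmod_2Rmax|].
  apply Rmult_le_compat_r.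
  - eapply Rle_trans; [apply Rabs_pos | apply Rmax_l].
  - rewrite <- (sqrt_square 2) at 2 by lra. apply sqrt_le_1_alt. lra.
Qed.

Lemma strict_deriv_Re F x y D :
  strict_deriv F (x, y) D ->
  differentiable_pt_lim (fun u v => Re (F (u, v))) x y (Re D) (- Im D).
Proof.
  intros (L & d & HL & Hd & H) eps.
  set (e := Rmin (d / 2) (eps / (4 * L + 1))).
  pose proof (cond_pos eps) as Heps.
  assert (He : 0 < e) by (apply Rmin_glb_lt; [lra | apply Rdiv_lt_0_compat; lra]).
  exists (mkposreal e He). simpl. intros u v Hu Hv.
  assert (He1 : e <= d / 2) by apply Rmin_l.
  assert (He2 : (4 * L + 1) * e <= eps).
  { replace (pos eps) with ((4 * L + 1) * (eps / (4 * L + 1))) by (field; lra).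
    apply Rmult_le_compat_l; [lra | apply Rmin_r]. }
  assert (E : ((u, v) - (x, y))%C = (u - x, v - y)) by reflexivity.
  pose proof (Cmod_le_2Rmax (u - x, v - y)) as HC. simpl fst in HC. simpl snd in HC.
  set (m := Rmax (Rabs (u - x)) (Rabs (v - y))) in *.
  assert (Hm : m < e) by (apply Rmax_lub_lt; auto).
  assert (Hm0 : 0 <= m) by (eapply Rle_trans; [apply Rabs_pos | apply Rmax_l]).
  specialize (H (u, v) (x, y) ltac:(rewrite E; lra) ltac:(rewrite Cmod_sub_self; lra)).
  rewrite Cmod_sub_self, E, Rplus_0_r in H.
  eapply Rle_trans; [|eapply Rle_trans; [exact H|]].
  - eapply Rle_trans; [|apply re_le_Cmod].
    right. f_equal. unfold Re, Im. simpl. ring.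
  - pose proof (Cmod_ge_0 (u - x, v - y)) as P0.
    set (c := Cmod (u - x, v - y)) in *.
    assert (c * c <= (2 * m) * (2 * m)) by (apply Rmult_le_compat; lra).
    assert (L * (c * c) <= L * (2 * m * (2 * m))) by (apply Rmult_le_compat_l; lra).
    assert (m * (4 * L * m) <= m * eps) by (apply Rmult_le_compat_l; nra).
    lra.
Qed.

Definition circle (s t : R) : C := (s * cos t, s * sin t).

Lemma Cmod_circle s t : Cmod (circle s t) = Rabs s.
Proof.
  unfold Cmod, circle; simpl.
  replace (s * cos t * (s * cos t * 1) + s * sin t * (s * sin t * 1))
    with (s * s * (Rsqr (sin t) + Rsqr (cos t))) by (unfold Rsqr; ring).
  rewrite sin2_cos2, Rmult_1_r. apply sqrt_Rsqr_abs.
Qed.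

Definition smooth_on_disk (F : C -> C) : Prop :=
  forall z, in_disk z -> forall N, smooth_at N F z.

(** The real part of [F'(s exp(i t)) exp(i t)] when [D] is the derivative of [F]. *)
Definition radial (D : C -> C) (s t : R) : R :=
  Re (D (circle s t)) * cos t - Im (D (circle s t)) * sin t.

Lemma radial_deriv F D s t :
  strict_deriv F (circle s t) (D (circle s t)) ->
  is_derive (fun s => Re (F (circle s t))) s (radial D s t).
Proof.
  intros H. apply is_derive_Reals.
  replace (radial D s t) with (Re (D (circle s t)) * cos t + - Im (D (circle s t)) * sin t)
    by (unfold radial; ring).
  apply (derivable_pt_lim_comp_2d (fun u v => Re (F (u, v))) (fun s => s * cos t) (fun s => s * sin t)).
  - now apply strict_deriv_Re.
  - apply is_derive_Reals. auto_derive; auto. ring.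
  - apply is_derive_Reals. auto_derive; auto. ring.
Qed.

(** The Cauchy-Riemann equation in polar coordinates: the angular derivative of
    [Im F] is [s] times the radial derivative of [Re F].  It comes from applying
    the chain rule to [Re (- i F) = Im F]. *)
Lemma angular_deriv F D s t :
  strict_deriv F (circle s t) (D (circle s t)) ->
  is_derive (fun t => Im (F (circle s t))) t (s * radial D s t).
Proof.
  intros H. apply (strict_deriv_scal _ _ _ (- Ci)%C) in H.
  apply strict_deriv_Re in H. 
  apply (is_derive_ext (fun t => Re (- Ci * F (circle s t))%C)).
  { intros u. unfold Re, Im. simpl. ring. }
  apply is_derive_Reals.
  replace (s * radial D s t) with
    (Re (- Ci * D (circle s t)) * (- s * sin t) + - Im (- Ci * D (circle s t)) * (s * cos t))
    by (unfold radial, Re, Im; simpl; ring).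
  apply (derivable_pt_lim_comp_2d (fun u v => Re (- Ci * F (u, v))%C) (fun t => s * cos t) (fun t => s * sin t)).
  - exact H.
  - apply is_derive_Reals. auto_derive; auto. ring.
  - apply is_derive_Reals. auto_derive; auto. ring.
Qed.

Lemma continuous_circle (p : R * R) :
  continuous (U := C_UniformSpace) (fun p : R * R => circle (fst p) (snd p)) p.
Proof.
  unfold circle.
  assert (Hs : continuous (fun p : R * R => fst p) p) by (destruct p; apply continuous_fst).
  assert (Ht : continuous (fun p : R * R => snd p) p) by (destruct p; apply continuous_snd).
  apply (continuous_comp_2 (fun p : R * R => fst p * cos (snd p)) (fun p : R * R => fst p * sin (snd p))
     (fun x y => (x, y) : C)).
  - apply (continuous_mult (K := R_AbsRing)); auto.
    apply (continuous_comp snd cos); auto. apply continuous_cos.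
  - apply (continuous_mult (K := R_AbsRing)); auto.
    apply (continuous_comp snd sin); auto. apply continuous_sin.
  - apply (continuous_ext (fun x => x)); [intros []; reflexivity | apply continuous_id].
Qed.

Lemma continuous_circle_t s t :
  continuous (U := C_UniformSpace) (circle s) t.
Proof.
  apply (continuous_comp_2 (fun _ : R => s) (fun t : R => t) circle).
  - apply continuous_const.
  - apply continuous_id.
  - apply continuous_circle.
Qed.

Lemma lipschitz_continuous_Re F z0 :
  lipschitz_at F z0 -> continuous (T := C_UniformSpace) (fun z => Re (F z)) z0.
Proof.
  intros H. apply continuous_near. intros eps He.
  eapply near_imp; [|exact (lipschitz_near F z0 eps H He)].
  intros z Hz. eapply Rle_lt_trans; [|exact Hz].
  replace (Re (F z) - Re (F z0)) with (Re (F z - F z0)) by reflexivity.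
  apply re_le_Cmod.
Qed.

Lemma lipschitz_continuous_Cmod F z0 :
  lipschitz_at F z0 -> continuous (T := C_UniformSpace) (fun z => Cmod (F z)) z0.
Proof.
  intros H. apply continuous_near. intros eps He.
  eapply near_imp; [|exact (lipschitz_near F z0 eps H He)].
  intros z Hz. eapply Rle_lt_trans; [|exact Hz]. simpl.
  pose proof (Cmod_sub_triangle (F z) (F z0)).
  pose proof (Cmod_sub_triangle (F z0) (F z)) as H1. rewrite Cmod_sub_sym in H1.
  apply Rabs_le. lra.
Qed.

Lemma near_disk z0 : in_disk z0 -> near z0 in_disk.
Proof.
  unfold in_disk. intros H. exists (1 - Cmod z0); split; [lra|].
  intros z Hz. pose proof (Cmod_sub_triangle z z0). lra.
Qed.

Lemma derivative_on_disk F :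
  smooth_on_disk F ->
  exists D, forall z, in_disk z -> strict_deriv F z (D z) /\
    forall eps, 0 < eps -> near z (fun w => Cmod (D w - D z) < eps).
Proof.
  intros HF.
  set (D := fun z => epsilon (inhabits (RtoC 0)) (strict_deriv F z)).
  assert (HD : forall z, in_disk z -> strict_deriv F z (D z)).
  { intros z Hz. apply epsilon_spec, smooth_strict_deriv, HF, Hz. }
  exists D. intros z Hz; split; auto. intros eps He.
  destruct (strict_deriv_lipschitz F z (D z) (HD z Hz)) as (L & HL & HN).
  assert (He' : 0 < eps / (L + 1)) by (apply Rdiv_lt_0_compat; lra).
  eapply near_imp; [|exact (near_and _ _ _ HN (near_and _ _ _ (near_disk z Hz) (near_ball z _ He')))].
  intros w [H1 [H2 H3]]. specialize (H1 _ (HD w H2)).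
  pose proof (Cmod_ge_0 (w - z)).
  apply (Rmult_lt_compat_l (L + 1)) in H3; [|lra].
  replace ((L + 1) * (eps / (L + 1))) with eps in H3 by (field; lra). lra.
Qed.

Lemma radial_continuous D s t :
  (forall eps, 0 < eps -> near (circle s t) (fun w => Cmod (D w - D (circle s t)) < eps)) ->
  continuous (fun p : R * R => radial D (fst p) (snd p)) (s, t).
Proof.
  intros H. unfold radial.
  assert (Ht : continuous (fun p : R * R => snd p) (s, t)) by apply continuous_snd.
  apply (continuous_minus (V := R_NormedModule)); apply (continuous_mult (K := R_AbsRing)).
  - apply (continuous_comp (V := C_UniformSpace) (fun p : R * R => circle (fst p) (snd p)) (fun z => Re (D z)));
      [apply continuous_circle|].
    apply continuous_near. intros eps He. eapply near_imp; [|exact (H eps He)].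
    intros w Hw. eapply Rle_lt_trans; [|exact Hw].
    exact (re_le_Cmod (D w - D (circle s t))).
  - apply (continuous_comp snd cos); auto. apply continuous_cos.
  - apply (continuous_comp (V := C_UniformSpace) (fun p : R * R => circle (fst p) (snd p)) (fun z => Im (D z)));
      [apply continuous_circle|].
    apply continuous_near. intros eps He. eapply near_imp; [|exact (H eps He)].
    intros w Hw. eapply Rle_lt_trans; [|exact Hw].
    eapply Rle_trans; [|apply Rmax_Cmod]. apply Rmax_r.
  - apply (continuous_comp snd sin); auto. apply continuous_sin.
Qed.

Lemma in_disk_circle s t : Rabs s < 1 -> in_disk (circle s t).
Proof. intros H; red. now rewrite Cmod_circle. Qed.

Lemma ex_RInt_circle (f : C -> R) s a b :
  (forall t, continuous (T := C_UniformSpace) f (circle s t)) ->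
  ex_RInt (fun t => f (circle s t)) a b.
Proof.
  intros H. apply (ex_RInt_continuous (V := R_CompleteNormedModule)).
  intros t _. apply (continuous_comp (V := C_UniformSpace) (circle s) f); auto.
  apply continuous_circle_t.
Qed.

(** The [s]-derivative of the integral over the circle of radius [s] is the
    integral of [radial], that is [1 / s] times the integral of the angular
    derivative of the periodic function [Im F], hence [0] for [s > 0].  So the
    integral is constant down to [s = 0], where it is [2 PI Re (F 0)]. *)
Lemma mean_value_Re F r :
  smooth_on_disk F -> 0 < r < 1 ->
  RInt (fun t => Re (F (circle r t))) 0 (2 * PI) = 2 * PI * Re (F (RtoC 0)).
Proof.
  intros HF Hr.
  destruct (derivative_on_disk F HF) as (D & HD).
  set (M := fun s => RInt (fun t => Re (F (circle s t))) 0 (2 * PI)).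
  assert (Hint : forall s, Rabs s < 1 -> ex_RInt (fun t => Re (F (circle s t))) 0 (2 * PI)).
  { intros s Hs. apply (ex_RInt_circle (fun z => Re (F z))).
    intros t. apply lipschitz_continuous_Re, (smooth_lipschitz 0), HF, in_disk_circle, Hs. }
  assert (Hd : forall s t, Rabs s < 1 -> is_derive (fun s => Re (F (circle s t))) s (radial D s t)).
  { intros s t Hs. apply radial_deriv, HD, in_disk_circle, Hs. }
  assert (Hloc : forall s, Rabs s < 1 -> exists d : posreal, forall y, Rabs (y - s) < d -> Rabs y < 1).
  { intros s Hs. exists (mkposreal (1 - Rabs s) ltac:(lra)). simpl. intros y Hy.
    pose proof (Rabs_triang_inv y s). lra. }
  assert (Hcont : forall s t, Rabs s < 1 -> continuous (fun p : R * R => radial D (fst p) (snd p)) (s, t)).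
  { intros s t Hs. apply radial_continuous, HD, in_disk_circle, Hs. }
  assert (HM : forall s, Rabs s < 1 -> is_derive M s (RInt (fun t => radial D s t) 0 (2 * PI))).
  { intros s Hs. destruct (Hloc s Hs) as [d Hdd].
    replace (RInt (fun t => radial D s t) 0 (2 * PI))
      with (RInt (fun t => Derive (fun u => Re (F (circle u t))) s) 0 (2 * PI)).
    2:{ apply RInt_ext. intros t _. apply is_derive_unique, Hd, Hs. }
    apply (is_derive_RInt_param (fun s t => Re (F (circle s t)))).
    - exists d. intros y Hy t _. exists (radial D y t). apply Hd, Hdd, Hy.
    - intros t _.
      apply (continuity_2d_pt_ext_loc (radial D)).
      + exists d. intros u v Hu _. symmetry. apply is_derive_unique, Hd, Hdd, Hu.
      + apply continuity_2d_pt_filterlim. exact (Hcont s t Hs).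
    - exists d. intros y Hy. apply Hint, Hdd, Hy. }
  assert (HZ : forall s, 0 < s < 1 -> RInt (fun t => radial D s t) 0 (2 * PI) = 0).
  { intros s Hs. assert (Hs' : Rabs s < 1) by (rewrite Rabs_pos_eq; lra).
    assert (Hc : forall t, continuous (radial D s) t).
    { intros t. apply (continuous_comp_2 (fun _ : R => s) (fun t : R => t) (radial D)).
      - apply continuous_const.
      - apply continuous_id.
      - exact (Hcont s t Hs'). }
    assert (I := is_RInt_derive (V := R_CompleteNormedModule) (fun t => Im (F (circle s t))) (fun t => s * radial D s t) 0 (2 * PI)
      (fun t _ => angular_deriv F D s t (proj1 (HD _ (in_disk_circle s t Hs'))))
      (fun t _ => continuous_mult (K := R_AbsRing) (fun _ => s) (radial D s) t (continuous_const _ _) (Hc t))).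
    apply is_RInt_unique in I.
    rewrite (RInt_scal (V := R_CompleteNormedModule)) in I.
    2:{ apply (ex_RInt_continuous (V := R_CompleteNormedModule)). intros; apply Hc. }
    assert (E : circle s (2 * PI) = circle s 0).
    { unfold circle. now rewrite cos_2PI, sin_2PI, cos_0, sin_0. }
    rewrite E in I.
    change (s * RInt (radial D s) 0 (2 * PI) = Im (F (circle s 0)) + - Im (F (circle s 0))) in I.
    apply (Rmult_eq_reg_l s); [|lra]. rewrite Rmult_0_r.
    change (s * RInt (radial D s) 0 (2 * PI) = 0). lra. }
  destruct (MVT_cor2 M (fun s => RInt (fun t => radial D s t) 0 (2 * PI)) 0 r (proj1 Hr)) as (c & Hc & Hc').
  { intros c Hc. apply is_derive_Reals, HM. rewrite Rabs_pos_eq; lra. }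
  rewrite HZ in Hc by lra.
  assert (M0 : M 0 = 2 * PI * Re (F (RtoC 0))).
  { unfold M. rewrite (RInt_ext _ (fun _ => Re (F (RtoC 0)))).
    - rewrite RInt_const. change ((2 * PI - 0) * Re (F (RtoC 0)) = 2 * PI * Re (F (RtoC 0))). ring.
    - intros t _. simpl. replace (circle 0 t) with (RtoC 0); [reflexivity|].
      apply injective_projections; simpl; ring. }
  fold (M r). lra.
Qed.

(** * Means over a circle, and the Schwarz lemma *)

Definition mean (r : R) (f : C -> R) : R :=
  / (2 * PI) * RInt (fun t => f (circle r t)) 0 (2 * PI).

Definition continuous_on_circle (r : R) (f : C -> R) : Prop :=
  forall t, continuous (T := C_UniformSpace) f (circle r t).

Lemma two_pi_pos : 0 < 2 * PI.
Proof. pose proof PI_RGT_0; lra. Qed.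

Lemma inv_two_pi_pos : 0 < / (2 * PI).
Proof. apply Rinv_0_lt_compat, two_pi_pos. Qed.

Lemma mean_le r f g :
  continuous_on_circle r f -> continuous_on_circle r g ->
  (forall t, f (circle r t) <= g (circle r t)) -> mean r f <= mean r g.
Proof.
  intros Hf Hg H. unfold mean.
  apply Rmult_le_compat_l; [apply Rlt_le, inv_two_pi_pos|].
  apply RInt_le; auto using ex_RInt_circle. apply Rlt_le, two_pi_pos.
Qed.

Lemma mean_plus r f g :
  continuous_on_circle r f -> continuous_on_circle r g ->
  mean r (fun z => f z + g z) = mean r f + mean r g.
Proof.
  intros Hf Hg. unfold mean. rewrite <- Rmult_plus_distr_l. f_equal.
  apply (RInt_plus (V := R_CompleteNormedModule)); now apply ex_RInt_circle.
Qed.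

Lemma mean_scal r c f :
  continuous_on_circle r f -> mean r (fun z => c * f z) = c * mean r f.
Proof.
  intros Hf. unfold mean. rewrite <- Rmult_assoc, (Rmult_comm c), Rmult_assoc.
  f_equal. apply (RInt_scal (V := R_CompleteNormedModule)); now apply ex_RInt_circle.
Qed.

Lemma mean_const r c : mean r (fun _ => c) = c.
Proof.
  unfold mean. rewrite RInt_const. 
  change (/ (2 * PI) * ((2 * PI - 0) * c) = c). pose proof two_pi_pos. field. lra.
Qed.

Lemma continuous_circle_plus r f g :
  continuous_on_circle r f -> continuous_on_circle r g ->
  continuous_on_circle r (fun z => f z + g z).
Proof. intros Hf Hg t. now apply (continuous_plus (V := R_NormedModule)). Qed.

Lemma continuous_circle_scal r c f :
  continuous_on_circle r f -> continuous_on_circle r (fun z => c * f z).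
Proof. intros Hf t. now apply (continuous_scal_r (V := R_NormedModule) c f). Qed.

Lemma continuous_circle_const r c : continuous_on_circle r (fun _ => c).
Proof. intros t. apply continuous_const. Qed.

Lemma continuous_circle_sq r F :
  smooth_on_disk F -> 0 < r < 1 -> continuous_on_circle r (fun z => Cmod (F z) ^ 2).
Proof.
  intros HF Hr t.
  assert (H : continuous (T := C_UniformSpace) (fun z => Cmod (F z)) (circle r t)).
  { apply lipschitz_continuous_Cmod, (smooth_lipschitz 0), HF, in_disk_circle.
    rewrite Rabs_pos_eq; lra. }
  apply (continuous_ext (T := C_UniformSpace) (fun z => Cmod (F z) * Cmod (F z))).
  - intros z. simpl. ring.
  - now apply (continuous_mult (U := C_UniformSpace) (K := R_AbsRing)).
Qed.

Lemma continuous_circle_Re r F :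
  smooth_on_disk F -> 0 < r < 1 -> continuous_on_circle r (fun z => Re (F z)).
Proof.
  intros HF Hr t. apply lipschitz_continuous_Re, (smooth_lipschitz 0), HF, in_disk_circle.
  rewrite Rabs_pos_eq; lra.
Qed.

Lemma L2_norm_mean r F : L2_norm r F = sqrt (mean r (fun z => Cmod (F z) ^ 2)).
Proof. reflexivity. Qed.

Lemma mean_Re F r :
  smooth_on_disk F -> 0 < r < 1 -> mean r (fun z => Re (F z)) = Re (F (RtoC 0)).
Proof.
  intros HF Hr. unfold mean. rewrite mean_value_Re by auto.
  pose proof two_pi_pos. field. lra.
Qed.

Lemma smooth_on_disk_const c : smooth_on_disk (fun _ => c).
Proof. intros z _ N. apply smooth_const. Qed.

Lemma smooth_on_disk_mul F G :
  smooth_on_disk F -> smooth_on_disk G -> smooth_on_disk (fun z => F z * G z)%C.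
Proof. intros HF HG z Hz N. apply smooth_mul; auto. Qed.

Lemma smooth_on_disk_sub F G :
  smooth_on_disk F -> smooth_on_disk G -> smooth_on_disk (fun z => F z - G z)%C.
Proof.
  intros HF HG z Hz N.
  apply (smooth_ext N (fun z => F z + (- (1)) * G z)%C).
  - exists 1; split; [lra|]. intros; ring.
  - apply smooth_add; auto. apply smooth_mul; auto. apply smooth_const.
Qed.

Lemma in_disk_0 : in_disk (RtoC 0).
Proof. red. rewrite Cmod_0. lra. Qed.

(** Orthogonality of [F - F(0)] to constants: the cross term
    [Re (conj (F 0) F)] has mean [|F 0|^2] by the mean value property. *)
Lemma mean_sq_center F r :
  smooth_on_disk F -> 0 < r < 1 ->
  mean r (fun z => Cmod (F z - F (RtoC 0)) ^ 2)
    = mean r (fun z => Cmod (F z) ^ 2) - Cmod (F (RtoC 0)) ^ 2.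
Proof.
  intros HF Hr. set (c := F (RtoC 0)).
  assert (HG : smooth_on_disk (fun z => Cconj c * F z)%C)
    by (apply smooth_on_disk_mul; auto using smooth_on_disk_const).
  pose proof (mean_Re _ r HG Hr) as E. cbv beta in E. fold c in E.
  pose proof (continuous_circle_Re r _ HG Hr) as K1.
  pose proof (continuous_circle_sq r _ HF Hr) as K2.
  assert (E1 : mean r (fun z => Cmod (F z - c) ^ 2)
     = mean r (fun z => Cmod (F z) ^ 2 + (-2 * Re (Cconj c * F z)%C + Cmod c ^ 2))).
  { unfold mean. f_equal. apply RInt_ext. intros t _.
    rewrite !Cmod2_alt. unfold Re, Im; simpl. ring. }
  rewrite E1, mean_plus, mean_plus, mean_scal, mean_const, E;
    auto using continuous_circle_plus, continuous_circle_scal, continuous_circle_const.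
  replace (Re (Cconj c * c)%C) with (Cmod c ^ 2)
    by (rewrite Cmod2_alt; unfold Re, Im; simpl; ring).
  ring.
Qed.

Lemma mean_sq_nonneg F r :
  smooth_on_disk F -> 0 < r < 1 -> 0 <= mean r (fun z => Cmod (F z) ^ 2).
Proof.
  intros HF Hr. rewrite <- (mean_const r 0).
  apply mean_le; auto using continuous_circle_const, continuous_circle_sq.
  intros t. apply pow2_ge_0.
Qed.

(** The left side of [mean_sq_center] is nonnegative. *)
Lemma center_le_mean_sq F r :
  smooth_on_disk F -> 0 < r < 1 ->
  Cmod (F (RtoC 0)) ^ 2 <= mean r (fun z => Cmod (F z) ^ 2).
Proof.
  intros HF Hr.
  pose proof (mean_sq_nonneg (fun z => F z - F (RtoC 0))%C r
    (smooth_on_disk_sub _ _ HF (smooth_on_disk_const _)) Hr) as H.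
  cbv beta in H. rewrite (mean_sq_center F r HF Hr) in H. lra.
Qed.

Definition mobius (a w : C) : C := ((w - a) / (1 - Cconj a * w))%C.

Lemma mobius_identity a w :
  Cmod (1 - Cconj a * w) ^ 2 - Cmod (w - a) ^ 2
    = (1 - Cmod a ^ 2) * (1 - Cmod w ^ 2).
Proof. rewrite !Cmod2_alt. unfold Re, Im; simpl. ring. Qed.

Lemma mobius_denominator a w :
  Cmod w <= 1 -> 1 - Cmod a <= Cmod (1 - Cconj a * w).
Proof.
  intros Hw. pose proof (Cmod_sub_triangle (RtoC 1) (1 - Cconj a * w)) as H.
  rewrite Cmod_1 in H. replace (1 - (1 - Cconj a * w))%C with (Cconj a * w)%C in H by ring.
  rewrite Cmod_mult, Cmod_conj in H. pose proof (Cmod_ge_0 a). nra.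
Qed.

Lemma mobius_denominator_neq0 a w :
  Cmod a < 1 -> Cmod w <= 1 -> (1 - Cconj a * w)%C <> RtoC 0.
Proof.
  intros Ha Hw. apply Cmod_gt_0. pose proof (mobius_denominator a w Hw). lra.
Qed.

(** The usual formula for [1 - |mobius a w|^2], cleared of its denominator. *)
Lemma mobius_sq a w :
  Cmod a < 1 -> Cmod w <= 1 ->
  (1 - Cmod (mobius a w) ^ 2) * Cmod (1 - Cconj a * w) ^ 2
    = (1 - Cmod a ^ 2) * (1 - Cmod w ^ 2).
Proof.
  intros Ha Hw. pose proof (mobius_denominator_neq0 a w Ha Hw) as Hn.
  rewrite <- mobius_identity. unfold mobius. rewrite Cmod_div by auto.
  apply Cmod_gt_0 in Hn. field. lra.
Qed.

Lemma mobius_le_1 a w : Cmod a < 1 -> Cmod w <= 1 -> Cmod (mobius a w) <= 1.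
Proof.
  intros Ha Hw. pose proof (mobius_sq a w Ha Hw) as E.
  pose proof (mobius_denominator a w Hw) as Hd.
  pose proof (Cmod_ge_0 a). pose proof (Cmod_ge_0 w). pose proof (Cmod_ge_0 (mobius a w)).
  assert (0 < Cmod (1 - Cconj a * w) ^ 2) by (apply pow_lt; lra).
  assert (0 <= (1 - Cmod a ^ 2) * (1 - Cmod w ^ 2)) by (apply Rmult_le_pos; nra).
  apply Rnot_lt_le. intros Hc.
  assert (0 < Cmod (mobius a w) ^ 2 - 1) by nra. nra.
Qed.

Lemma mobius_lt_1 a w : Cmod a < 1 -> Cmod w < 1 -> Cmod (mobius a w) < 1.
Proof.
  intros Ha Hw. pose proof (mobius_sq a w Ha ltac:(lra)) as E.
  pose proof (mobius_denominator a w ltac:(lra)) as Hd.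
  pose proof (Cmod_ge_0 a). pose proof (Cmod_ge_0 w). pose proof (Cmod_ge_0 (mobius a w)).
  assert (0 < Cmod (1 - Cconj a * w) ^ 2) by (apply pow_lt; lra).
  assert (0 < (1 - Cmod a ^ 2) * (1 - Cmod w ^ 2)) by (apply Rmult_lt_0_compat; nra).
  apply Rnot_le_lt. intros Hc.
  assert (0 <= Cmod (mobius a w) ^ 2 - 1) by nra. nra.
Qed.

Lemma smooth_mobius N a F z :
  Cmod a < 1 -> Cmod (F z) <= 1 -> smooth_at N F z ->
  smooth_at N (fun z => mobius a (F z)) z.
Proof.
  intros Ha Hw HF. unfold mobius, Cdiv.
  assert (Hs : forall b c, smooth_at N (fun z => b + c * F z)%C z).
  { intros b c. apply smooth_add; [apply smooth_const|].
    apply smooth_mul; auto. apply smooth_const. }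
  apply smooth_mul; [|apply smooth_inv; [now apply mobius_denominator_neq0|]].
  - apply (smooth_ext N (fun z => - a + RtoC 1 * F z)%C); [|apply Hs].
    exists 1; split; [lra|]. intros; ring.
  - apply (smooth_ext N (fun z => RtoC 1 + (- Cconj a) * F z)%C); [|apply Hs].
    exists 1; split; [lra|]. intros; ring.
Qed.

(** The class on which the Schur algorithm runs: [schur_step] preserves
    it as soon as the value at [0] is not unimodular. *)
Definition schur_smooth (F : C -> C) : Prop :=
  smooth_on_disk F /\ forall z, in_disk z -> Cmod (F z) <= 1.

Lemma schur_class_smooth F : schur_class F -> schur_smooth F.
Proof.
  intros [H1 H2]; split; auto. intros z Hz N. now apply analytic_smooth, H1.
Qed.

Lemma schur_quotient_step F : forall z, z <> RtoC 0 ->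
  schur_quotient F z = schur_step F z.
Proof.
  intros z Hz. unfold schur_step. destruct (Ceq_dec z (RtoC 0)); easy.
Qed.

Lemma near_neq (z0 : C) : z0 <> RtoC 0 -> near z0 (fun z => z <> RtoC 0).
Proof.
  intros H. apply Cmod_gt_0 in H. exists (Cmod z0); split; auto.
  intros z Hz E. subst z. rewrite Cmod_sub_sym in Hz.
  replace (z0 - 0)%C with z0 in Hz by ring. lra.
Qed.

(** Away from [0] the step is a quotient.  At [0] the Moebius image of [F]
    vanishes, so its expansion of order [N + 1] is [z G] with [G] of order [N]; by
    continuity of [G], the limit used to define the step at [0] is [G 0], and the
    step coincides with [G] near [0]. *)
Lemma schur_step_smooth F :
  schur_smooth F -> Cmod (F (RtoC 0)) < 1 -> smooth_on_disk (schur_step F).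
Proof.
  intros [HF HB] Ha z0 Hz0 N. set (a := F (RtoC 0)) in *.
  assert (HT : smooth_at (S N) (fun z => mobius a (F z)) z0)
    by (apply smooth_mobius; auto).
  destruct (Ceq_dec z0 (RtoC 0)) as [-> | Hz].
  - destruct HT as (G & HG & E).
    assert (E' : near (RtoC 0) (fun z => mobius a (F z) = z * G z)%C).
    { eapply near_imp; [|exact E]. intros z ->. fold a. unfold mobius.
      replace (a - a)%C with (RtoC 0) by ring. unfold Cdiv. ring. }
    assert (EQ : near (RtoC 0) (fun z => z <> RtoC 0 -> schur_quotient F z = G z)).
    { eapply near_imp; [|exact E']. intros z Ez Hz. unfold schur_quotient.
      change ((mobius a (F z) / z)%C = G z). rewrite Ez. field. exact Hz. }
    assert (EL : C_lim (schur_quotient F) (RtoC 0) = G (RtoC 0)).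
    { apply is_C_lim_unique. intros P [eps HP].
      unfold filtermap, locally', within.
      apply near_locally.
      pose proof (lipschitz_near G (RtoC 0) eps (smooth_lipschitz _ _ _ HG) (cond_pos eps)) as HL.
      eapply near_imp; [|exact (near_and _ _ _ EQ HL)].
      intros z [E1 E2] Hz. rewrite (E1 Hz). apply HP.
      apply C_NormedModule_mixin_compat1. exact E2. }
    apply (smooth_ext N G); auto.
    eapply near_imp; [|exact EQ]. intros z Hz. unfold schur_step.
    destruct (Ceq_dec z (RtoC 0)) as [-> | Hn]; [now rewrite EL | now rewrite Hz].
  - apply (smooth_ext N (fun z => mobius a (F z) * / z)%C).
    + eapply near_imp; [|exact (near_neq z0 Hz)]. intros z Hn.
      rewrite <- schur_quotient_step by auto. reflexivity.
    + apply smooth_mul; [now apply smooth_pred|].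
      apply (smooth_inv N (fun z => z)); auto. apply smooth_id.
Qed.

Lemma schur_step_mobius F z :
  (z * schur_step F z)%C = mobius (F (RtoC 0)) (F z).
Proof. apply schur_step_eq. Qed.

(** The Schwarz lemma.  Precompose the step with the disk automorphism sending
    [0] to [z0] and call the result [h]; then [|h w| <= 1 / |mobius b w|], and the
    right side tends to [1] as [|w|] tends to [1].  Since [|h 0|^2] is at most the
    mean of [|h|^2] over the circle of radius [s], letting [s] tend to [1] gives
    the bound. *)
Lemma schur_step_bound F z0 :
  schur_smooth F -> Cmod (F (RtoC 0)) < 1 -> in_disk z0 ->
  Cmod (schur_step F z0) <= 1.
Proof.
  intros HF Ha Hz0. pose proof (schur_step_smooth F HF Ha) as HS.
  destruct HF as [HF HB]. set (b := (- z0)%C).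
  assert (Hb : Cmod b < 1) by (unfold b; rewrite Cmod_opp; exact Hz0).
  set (h := fun w => schur_step F (mobius b w)).
  assert (Hh : smooth_on_disk h).
  { intros w Hw N. apply (smooth_comp N (schur_step F) (mobius b)); [apply HS, mobius_lt_1; auto|].
    apply (smooth_mobius N b (fun w => w)); auto; [apply Rlt_le, Hw | apply smooth_id]. }
  assert (Hh0 : h (RtoC 0) = schur_step F z0).
  { unfold h. f_equal. unfold mobius, b. field.
}
  (* [kappa] is such that [1 - |mobius b w|^2 <= kappa (1 - |w|^2)] on the disk. *)
  set (kappa := (1 - Cmod b ^ 2) / (1 - Cmod b) ^ 2).
  pose proof (Cmod_ge_0 b) as Hb0.
  assert (Hk : 0 <= kappa).
  { apply Rle_mult_inv_pos; [nra | apply pow_lt; lra]. }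
  assert (Hlow : forall w, in_disk w ->
     (1 - kappa * (1 - Cmod w ^ 2)) * Cmod (h w) ^ 2 <= 1).
  { intros w Hw. red in Hw.
    pose proof (mobius_sq b w Hb ltac:(lra)) as E.
    pose proof (mobius_denominator b w ltac:(lra)) as Hd.
    pose proof (mobius_lt_1 b w Hb Hw) as Hm.
    set (m := Cmod (mobius b w)) in *. set (d := Cmod (1 - Cconj b * w)) in *.
    assert (E2 : m * Cmod (h w) <= 1).
    { unfold m, h. rewrite <- Cmod_mult, schur_step_mobius. apply mobius_le_1; auto. }
    assert (E3 : 1 - kappa * (1 - Cmod w ^ 2) <= m ^ 2).
    { apply (Rmult_le_reg_r (d ^ 2)); [apply pow_lt; lra|].
      assert (kappa * (1 - Cmod b) ^ 2 = 1 - Cmod b ^ 2) by (unfold kappa; field; lra).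
      assert ((1 - Cmod b) ^ 2 <= d ^ 2) by (apply pow_incr; lra).
      pose proof (Cmod_ge_0 w). assert (0 <= 1 - Cmod w ^ 2) by nra.
      assert (kappa * (1 - Cmod w ^ 2) * (1 - Cmod b) ^ 2 <= kappa * (1 - Cmod w ^ 2) * d ^ 2).
      { apply Rmult_le_compat_l; auto. apply Rmult_le_pos; auto. }
      nra. }
    pose proof (Cmod_ge_0 (h w)). pose proof (Cmod_ge_0 (mobius b w)). fold m in H0.
    apply Rle_trans with (m ^ 2 * Cmod (h w) ^ 2).
    - apply Rmult_le_compat_r; auto. apply pow2_ge_0.
    - rewrite <- Rpow_mult_distr. rewrite <- (pow1 2). apply pow_incr. split; auto.
      apply Rmult_le_pos; auto. }
  set (x := Cmod (h (RtoC 0))). 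
  assert (Hx : x ^ 2 <= 1).
  { apply (Rle_of_small_perturbation _ _ (2 * kappa * x ^ 2) 1); [lra| |].
    { pose proof (pow2_ge_0 x). nra. }
    intros e He He1. set (s := 1 - e).
    assert (Hs : 0 < s < 1) by (unfold s; lra).
    set (m := 1 - kappa * (1 - s ^ 2)).
    assert (Hm : m * x ^ 2 <= 1).
    { destruct (Rle_or_lt m 0) as [Hm | Hm]; [pose proof (pow2_ge_0 x); nra|].
      apply Rle_trans with (m * mean s (fun z => Cmod (h z) ^ 2)).
      - apply Rmult_le_compat_l; [lra|]. apply center_le_mean_sq; auto.
      - rewrite <- mean_scal by now apply continuous_circle_sq.
        rewrite <- (mean_const s 1).
        apply mean_le; auto using continuous_circle_scal, continuous_circle_const, continuous_circle_sq.
        intros t. assert (Hc : Cmod (circle s t) = s) by (rewrite Cmod_circle, Rabs_pos_eq; lra).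
        unfold m. rewrite <- Hc at 1. apply Hlow. red. lra. }
    (* [1 - s^2 <= 2 e], which is where the factor [2 kappa] comes from. *)
    unfold m, s in Hm. pose proof (pow2_ge_0 x).
    assert (0 <= kappa * x ^ 2) by (apply Rmult_le_pos; auto).
    nra. }
  rewrite <- Hh0. fold x. pose proof (Cmod_ge_0 (h (RtoC 0))). fold x in H. nra.
Qed.

Lemma schur_step_schur_smooth F :
  schur_smooth F -> Cmod (F (RtoC 0)) < 1 -> schur_smooth (schur_step F).
Proof.
  intros HF Ha; split; [now apply schur_step_smooth|].
  intros z Hz. now apply schur_step_bound.
Qed.

(** * Schur parameters *)

Lemma prod_f_R0_zero f n m : f n = 0 -> (n <= m)%nat -> prod_f_R0 f m = 0.
Proof.
  intros H0 Hm. induction Hm as [|m Hm IH].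
  - destruct n; simpl; rewrite H0; ring.
  - simpl. rewrite IH. ring.
Qed.

(** A unimodular parameter makes all later partial products vanish, whatever the
    subsequent iterates are. *)
Lemma schur_eta_zero F n :
  Cmod (schur_iter F n (RtoC 0)) = 1 -> schur_eta F = 0.
Proof.
  intros H. unfold schur_eta.
  rewrite (Lim_seq_ext_loc _ (fun _ => 0)); [now rewrite Lim_seq_const|].
  exists n. intros m Hm. apply (prod_f_R0_zero _ n m); auto. rewrite H. ring.
Qed.

(** The bound by [1] at the center comes from the Schwarz lemma at the previous
    step; the value [1] itself is excluded by [schur_eta_zero]. *)
Lemma schur_iter_smooth F :
  schur_smooth F -> 0 < schur_eta F ->
  forall n, schur_smooth (schur_iter F n) /\ Cmod (schur_iter F n (RtoC 0)) < 1.
Proof.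
  intros HF Heta.
  assert (A : forall n, schur_smooth (schur_iter F n) -> Cmod (schur_iter F n (RtoC 0)) < 1).
  { intros n [_ H]. destruct (Rle_lt_or_eq_dec _ _ (H _ in_disk_0)) as [Hlt | E]; auto.
    rewrite (schur_eta_zero F n E) in Heta. lra. }
  induction n as [|n [IH1 IH2]]; [split; auto|].
  assert (schur_smooth (schur_iter F (S n))) by (now apply schur_step_schur_smooth).
  split; auto.
Qed.

Fixpoint sum_lt (f : nat -> R) (n : nat) : R :=
  match n with O => 0 | S n => sum_lt f n + f n end.

(** From [1 - x <= exp (- x)]. *)
Lemma prod_le_exp (x : nat -> R) n :
  (forall k, 0 <= x k <= 1) ->
  0 <= prod_f_R0 (fun k => 1 - x k) n <= exp (- sum_lt x (S n)).
Proof.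
  intros Hx.
  assert (E : forall k, 0 <= 1 - x k <= exp (- x k)).
  { intros k. pose proof (exp_ineq1_le (- x k)). specialize (Hx k). lra. }
  induction n as [|n IH].
  - specialize (E 0%nat). simpl in *. replace (- (0 + x 0%nat)) with (- x 0%nat) by ring. exact E.
  - simpl prod_f_R0. specialize (E (S n)). split; [apply Rmult_le_pos; lra|].
    replace (- sum_lt x (S (S n))) with (- sum_lt x (S n) + - x (S n)) by (simpl; ring).
    rewrite exp_plus. apply Rmult_le_compat; lra.
Qed.

Lemma prod_le_factor (x : nat -> R) n :
  (forall k, 0 <= x k <= 1) ->
  0 <= prod_f_R0 (fun k => 1 - x k) n <= 1 /\ prod_f_R0 (fun k => 1 - x k) n <= 1 - x n.
Proof.
  intros Hx. induction n as [|n [[IH1 IH2] IH3]]; simpl.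
  - specialize (Hx 0%nat); lra.
  - specialize (Hx (S n)). set (p := prod_f_R0 _ n) in *. nra.
Qed.

Lemma schur_eta_le_prod F n :
  schur_smooth F -> 0 < schur_eta F ->
  schur_eta F <= prod_f_R0 (fun k => 1 - Cmod (schur_iter F k (RtoC 0)) ^ 2) n.
Proof.
  intros HF Heta. set (x := fun k => Cmod (schur_iter F k (RtoC 0)) ^ 2).
  assert (Hx : forall k, 0 <= x k <= 1).
  { intros k. destruct (schur_iter_smooth F HF Heta k) as [_ H]. unfold x.
    pose proof (Cmod_ge_0 (schur_iter F k (RtoC 0))). nra. }
  change (schur_eta F) with (real (Lim_seq (prod_f_R0 (fun k => 1 - x k)))).
  change (real (Lim_seq (prod_f_R0 (fun k => 1 - x k))) <= prod_f_R0 (fun k => 1 - x k) n).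
  pose proof (prod_le_factor x n Hx) as [[P0 _] _].
  assert (L : Rbar_le (Lim_seq (prod_f_R0 (fun k => 1 - x k))) (prod_f_R0 (fun k => 1 - x k) n)).
  { rewrite <- Lim_seq_const. apply Lim_seq_le_loc. exists n.
    intros m Hm. induction Hm as [|m Hm IH]; [lra|]. simpl.
    pose proof (prod_le_factor x m Hx). specialize (Hx (S m)).
    set (p := prod_f_R0 _ m) in *. nra. }
  destruct (Lim_seq _) as [l| |]; simpl in *; auto; contradiction.
Qed.

(** Every partial product is at least [eta].  It is at most its last factor,
    which gives the individual bound, and at most the exponential of minus the
    sum of squares, which gives the bound on the sum. *)
Lemma schur_parameters_bounds F eta :
  schur_smooth F -> 0 < eta -> eta <= schur_eta F ->
  (forall n, 0 <= Cmod (schur_iter F n (RtoC 0)) <= sqrt (1 - eta)) /\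
  (forall n, sum_lt (fun k => Cmod (schur_iter F k (RtoC 0)) ^ 2) n <= ln (/ eta)) /\
  eta <= 1.
Proof.
  intros HF H0 He. set (x := fun k => Cmod (schur_iter F k (RtoC 0)) ^ 2).
  assert (Hx : forall k, 0 <= x k <= 1).
  { intros k. destruct (schur_iter_smooth F HF ltac:(lra) k) as [_ H]. unfold x.
    pose proof (Cmod_ge_0 (schur_iter F k (RtoC 0))). nra. }
  assert (P : forall n, eta <= prod_f_R0 (fun k => 1 - x k) n)
    by (intros n; eapply Rle_trans; [exact He | apply schur_eta_le_prod; auto; lra]).
  assert (Q : forall n, sum_lt x (S n) <= ln (/ eta)).
  { intros n. rewrite ln_Rinv by auto.
    assert (ln eta <= - sum_lt x (S n)); [|lra].
    rewrite <- (ln_exp (- sum_lt x (S n))). apply ln_le; auto.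
    eapply Rle_trans; [apply P | apply prod_le_exp, Hx]. }
  assert (E1 : eta <= 1).
  { pose proof (prod_le_factor x 0 Hx). specialize (P 0%nat). lra. }
  repeat split; auto.
  - apply Cmod_ge_0.
  - rewrite <- (sqrt_pow2 (Cmod _)) by apply Cmod_ge_0.
    apply sqrt_le_1_alt. fold (x n). pose proof (prod_le_factor x n Hx). specialize (P n). lra.
  - intros [|n]; [|apply Q]. simpl. specialize (Q 0%nat). specialize (Hx 0%nat). simpl in Q. lra.
Qed.

(** The solution of [q n = a n ^ 2 / (1 - r) + r * q (n + 1)] that stays bounded;
    see [tail_majorant_rec]. *)
Definition tail_majorant (r : R) (a : nat -> R) (n : nat) : R :=
  / (1 - r) * Series (fun k => r ^ k * a (n + k)%nat ^ 2).

Lemma tail_ex_series r a n :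
  0 < r < 1 -> (forall k, 0 <= a k <= 1) ->
  ex_series (fun k => r ^ k * a (n + k)%nat ^ 2).
Proof.
  intros Hr Ha. apply (ex_series_le (K := R_AbsRing) (V := R_CompleteNormedModule) _ (fun k => r ^ k)).
  - intros k. change (Rabs (r ^ k * a (n + k)%nat ^ 2) <= r ^ k).
    pose proof (pow_lt r k (proj1 Hr)). specialize (Ha (n + k)%nat).
    assert (0 <= a (n + k)%nat ^ 2 <= 1) by nra.
    rewrite Rabs_pos_eq; nra.
  - exists (/ (1 - r)). apply is_series_geom. rewrite Rabs_pos_eq; lra.
Qed.

Lemma tail_majorant_rec r a n :
  0 < r < 1 -> (forall k, 0 <= a k <= 1) ->
  tail_majorant r a n = a n ^ 2 / (1 - r) + r * tail_majorant r a (S n).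
Proof.
  intros Hr Ha. unfold tail_majorant.
  rewrite Series_incr_1 by now apply tail_ex_series.
  replace (Series (fun k => r ^ S k * a (n + S k)%nat ^ 2))
    with (r * Series (fun k => r ^ k * a (S n + k)%nat ^ 2)).
  - rewrite Nat.add_0_r. simpl (r ^ 0). field. lra.
  - rewrite <- Series_scal_l. apply Series_ext. intros k.
    rewrite Nat.add_succ_r. simpl. ring.
Qed.

Lemma tail_majorant_nonneg r a n :
  0 < r < 1 -> (forall k, 0 <= a k <= 1) -> 0 <= tail_majorant r a n.
Proof.
  intros Hr Ha. apply Rmult_le_pos; [apply Rlt_le, Rinv_0_lt_compat; lra|].
  set (f := fun k => r ^ k * a (n + k)%nat ^ 2).
  replace 0 with (Series (fun k => 0 * f k)) by (rewrite Series_scal_l; ring).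
  apply Series_le; [|now apply tail_ex_series].
  intros k. assert (0 <= f k); [|lra].
  apply Rmult_le_pos; [apply pow_le; lra | apply pow2_ge_0].
Qed.

(** Drop the weights [r ^ k <= 1]: what remains is a tail of the sum of squares.
    This controls the boundary term in [tail_majorant_sum]. *)
Lemma tail_majorant_le r a A n :
  0 < r < 1 -> (forall k, 0 <= a k <= 1) ->
  (forall n, sum_lt (fun k => a k ^ 2) n <= A) ->
  tail_majorant r a n <= (A - sum_lt (fun k => a k ^ 2) n) / (1 - r).
Proof.
  intros Hr Ha HA. unfold tail_majorant, Rdiv. rewrite Rmult_comm.
  apply Rmult_le_compat_r; [apply Rlt_le, Rinv_0_lt_compat; lra|].
  pose proof (Series_correct _ (tail_ex_series r a n Hr Ha)) as L.
  set (B := A - sum_lt (fun k => a k ^ 2) n).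
  change (Rbar_le (Series (fun k => r ^ k * a (n + k)%nat ^ 2)) B).
  apply (is_lim_seq_le (sum_n (fun k => r ^ k * a (n + k)%nat ^ 2)) (fun _ => B));
    [|exact L | apply is_lim_seq_const].
  intros m. rewrite sum_n_Reals.
  enough (E : sum_f_R0 (fun k => r ^ k * a (n + k)%nat ^ 2) m
    + sum_lt (fun k => a k ^ 2) n <= sum_lt (fun k => a k ^ 2) (n + S m)).
  { specialize (HA (n + S m)%nat). unfold B. lra. }
  assert (T : forall k, r ^ k * a (n + k)%nat ^ 2 <= a (n + k)%nat ^ 2).
  { intros k. pose proof (pow2_ge_0 (a (n + k)%nat)).
    assert (r ^ k <= 1) by (rewrite <- (pow1 k); apply pow_incr; lra).
    nra. }
  induction m as [|m IH].
  - rewrite Nat.add_1_r. specialize (T 0%nat). cbn [sum_lt sum_f_R0].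
    rewrite Nat.add_0_r in T |- *. lra.
  - rewrite tech5. replace (n + S (S m))%nat with (S (n + S m)) by lia.
    specialize (T (S m)). cbn [sum_lt]. lra.
Qed.

(** Summing the recursion telescopes to
    [(1 - r) sum_(k < n) q k + r q 0 = r q n + (1 - r)^-1 sum_(k < n) a k ^ 2], and
    [q n] is at most the rest of the sum of squares divided by [1 - r]. *)
Lemma tail_majorant_sum r a A n :
  0 < r < 1 -> (forall k, 0 <= a k <= 1) ->
  (forall n, sum_lt (fun k => a k ^ 2) n <= A) ->
  sum_lt (tail_majorant r a) n <= A / (1 - r) ^ 2.
Proof.
  intros Hr Ha HA.
  assert (E : (1 - r) * sum_lt (tail_majorant r a) n + r * tail_majorant r a 0
     = r * tail_majorant r a n + sum_lt (fun k => a k ^ 2) n / (1 - r)).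
  { induction n as [|n IH]; cbn [sum_lt]; [field; lra|].
    pose proof (tail_majorant_rec r a n Hr Ha) as Q.
    replace ((sum_lt (fun k => a k ^ 2) n + a n ^ 2) / (1 - r))
      with (sum_lt (fun k => a k ^ 2) n / (1 - r) + a n ^ 2 / (1 - r)) by (field; lra).
    lra. }
  pose proof (tail_majorant_nonneg r a 0 Hr Ha) as P0.
  pose proof (tail_majorant_nonneg r a n Hr Ha) as Pn.
  pose proof (tail_majorant_le r a A n Hr Ha HA) as U.
  assert (V : (1 - r) * sum_lt (tail_majorant r a) n <= A / (1 - r)).
  { replace (A / (1 - r)) with ((A - sum_lt (fun k => a k ^ 2) n) / (1 - r)
       + sum_lt (fun k => a k ^ 2) n / (1 - r)) by (field; lra).
    assert (0 <= r * tail_majorant r a 0) by (apply Rmult_le_pos; lra).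
    assert (r * tail_majorant r a n <= 1 * tail_majorant r a n) by (apply Rmult_le_compat_r; lra).
    lra. }
  apply (Rmult_le_reg_l (1 - r)); [lra|].
  replace ((1 - r) * (A / (1 - r) ^ 2)) with (A / (1 - r)) by (field; lra). exact V.
Qed.

(** Convexity of the square, with weights [1 - r] and [r] on [a / (1 - r)] and
    [s], turns the hypothesis into [s k ^ 2 <= a k ^ 2 / (1 - r) + r s (k+1) ^ 2].
    Hence [s ^ 2 - q] is at most [r ^ m] times a quantity bounded by [1], for
    every [m]. *)
Lemma tail_majorant_spec r a s n :
  0 < r < 1 -> (forall k, 0 <= a k <= 1) -> (forall k, 0 <= s k <= 1) ->
  (forall k, s k <= a k + r * s (S k)) ->
  s n ^ 2 <= tail_majorant r a n.
Proof.
  intros Hr Ha Hs H. set (q := tail_majorant r a).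
  assert (H2 : forall k, s k ^ 2 <= a k ^ 2 / (1 - r) + r * s (S k) ^ 2).
  { intros k. specialize (H k). pose proof (Hs k). pose proof (Hs (S k)). pose proof (Ha k).
    apply Rle_trans with ((a k + r * s (S k)) ^ 2); [apply pow_incr; lra|].
    apply Rminus_le_0.
    replace (a k ^ 2 / (1 - r) + r * s (S k) ^ 2 - (a k + r * s (S k)) ^ 2)
      with (r * (a k - (1 - r) * s (S k)) ^ 2 / (1 - r)) by (field; lra).
    apply Rle_mult_inv_pos; [|lra]. apply Rmult_le_pos; [lra | apply pow2_ge_0]. }
  assert (H3 : forall m, s n ^ 2 <= q n + r ^ m).
  { assert (H4 : forall m n, s n ^ 2 - q n <= r ^ m * (s (n + m)%nat ^ 2 - q (n + m)%nat)).
    { induction m as [|m IH]; intros k.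
      - rewrite Nat.add_0_r. simpl. lra.
      - specialize (IH (S k)). rewrite Nat.add_succ_r. simpl Nat.add in IH.
        specialize (H2 k). unfold q at 1. rewrite (tail_majorant_rec r a k Hr Ha). fold q.
        apply (Rmult_le_compat_l r) in IH; [|lra]. simpl pow in *. lra. }
    intros m. specialize (H4 m n).
    pose proof (tail_majorant_nonneg r a (n + m) Hr Ha) as Q. fold q in Q.
    specialize (Hs (n + m)%nat). pose proof (pow_lt r m (proj1 Hr)).
    assert (s (n + m)%nat ^ 2 - q (n + m)%nat <= 1) by nra. nra. }
  change (Rbar_le (s n ^ 2) (q n)).
  apply (is_lim_seq_le (fun _ => s n ^ 2) (fun m => q n + r ^ m)); auto.
  - apply is_lim_seq_const.
  - replace (q n) with (q n + 0) at 1 by ring.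
    apply (is_lim_seq_plus' (fun _ => q n)); [apply is_lim_seq_const|].
    apply is_lim_seq_geom. rewrite Rabs_pos_eq; lra.
Qed.

(** With [x = |a|], [f = |w|] and [t = |mobius a w|], the identity [mobius_sq] and
    [|1 - conj a w| >= 1 - x f] give [(f - x)^2 <= t^2 (1 - x f)^2]. *)
Lemma Cmod_le_mobius a w :
  Cmod a < 1 -> Cmod w <= 1 -> Cmod w <= Cmod a + Cmod (mobius a w).
Proof.
  intros Ha Hw. pose proof (mobius_sq a w Ha Hw) as E.
  pose proof (mobius_le_1 a w Ha Hw) as H1.
  pose proof (Cmod_sub_triangle (RtoC 1) (1 - Cconj a * w)) as H.
  rewrite Cmod_1 in H. replace (1 - (1 - Cconj a * w))%C with (Cconj a * w)%C in H by ring.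
  rewrite Cmod_mult, Cmod_conj in H.
  pose proof (Cmod_ge_0 a) as P1. pose proof (Cmod_ge_0 w) as P2.
  pose proof (Cmod_ge_0 (mobius a w)) as P3.
  set (t := Cmod (mobius a w)) in *. set (d := Cmod (1 - Cconj a * w)) in *.
  set (x := Cmod a) in *. set (f := Cmod w) in *.
  assert (P4 : 0 <= 1 - x * f) by nra.
  assert ((1 - x * f) ^ 2 <= d ^ 2) by (apply pow_incr; lra).
  assert (0 <= 1 - t ^ 2) by nra.
  assert (K : (f - x) ^ 2 <= (t * (1 - x * f)) ^ 2) by nra.
  assert (f - x <= t * (1 - x * f)).
  { apply Rnot_lt_le. intros Hc. assert (0 <= t * (1 - x * f)) by (apply Rmult_le_pos; auto). nra. }
  assert (0 <= x * f) by (apply Rmult_le_pos; auto). nra.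
Qed.

Lemma schur_iter_majorant F r n t :
  schur_smooth F -> 0 < schur_eta F -> 0 < r < 1 ->
  Cmod (schur_iter F n (circle r t)) ^ 2
    <= tail_majorant r (fun k => Cmod (schur_iter F k (RtoC 0))) n.
Proof.
  intros HF He Hr. pose proof (schur_iter_smooth F HF He) as HI.
  assert (Hz : Cmod (circle r t) = r) by (rewrite Cmod_circle, Rabs_pos_eq; lra).
  assert (Hd : in_disk (circle r t)) by (red; lra).
  apply (tail_majorant_spec r (fun k => Cmod (schur_iter F k (RtoC 0)))
    (fun k => Cmod (schur_iter F k (circle r t)))); auto.
  - intros k. split; [apply Cmod_ge_0 | apply Rlt_le, HI].
  - intros k. split; [apply Cmod_ge_0 | apply HI, Hd].
  - intros k. destruct (HI k) as [[_ Hb] Ha].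
    eapply Rle_trans; [apply Cmod_le_mobius; [exact Ha | apply Hb, Hd]|].
    rewrite <- schur_step_mobius, Cmod_mult, Hz. apply Rle_refl.
Qed.

(** * Stability of the Schur algorithm *)

(** Subtract [z G' (1 - conj a F)] from [z F' (1 - conj a F) = F - a] and use
    [conj a F - conj b G = conj a (F - G) + conj (a - b) G].  Clearing the
    denominator of [F] alone leaves a single factor [1 / (1 - |a|)] in the
    estimates. *)
Lemma schur_step_difference F G z :
  (1 - Cconj (F (RtoC 0)) * F z)%C <> RtoC 0 ->
  (1 - Cconj (G (RtoC 0)) * G z)%C <> RtoC 0 ->
  (z * (schur_step F z - schur_step G z) * (1 - Cconj (F (RtoC 0)) * F z)
   = (F z - G z) - (F (RtoC 0) - G (RtoC 0))
     + z * schur_step G z * (Cconj (F (RtoC 0)) * (F z - G z)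
         + Cconj (F (RtoC 0) - G (RtoC 0)) * G z))%C.
Proof.
  intros HF HG.
  pose proof (schur_step_mobius F z) as EF. pose proof (schur_step_mobius G z) as EG.
  rewrite Cminus_conj. unfold mobius in *.
  set (a := F (RtoC 0)) in *. set (b := G (RtoC 0)) in *.
  set (a' := Cconj a) in *. set (b' := Cconj b) in *.
  replace (z * (schur_step F z - schur_step G z))%C
    with (z * schur_step F z - z * schur_step G z)%C by ring.
  rewrite EF, EG. field. auto.
Qed.

(** Divide [schur_step_difference] by [1 - conj a F].  The main term [h - h0] must
    keep the coefficient [1] up to second order, so it uses
    [1 / (1 - x) = 1 + x / (1 - x)], while the other terms only use
    [1 / |1 - conj a F| <= K]. *)
Lemma schur_step_pointwise F G z r K :
  schur_smooth F -> schur_smooth G ->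
  Cmod (F (RtoC 0)) < 1 -> Cmod (G (RtoC 0)) < 1 ->
  Cmod z = r -> 0 < r < 1 -> 1 <= K * (1 - Cmod (F (RtoC 0))) ->
  r * Cmod (schur_step F z - schur_step G z)
  <= (1 + K * (Cmod (F (RtoC 0)) * Cmod (F z)))
       * Cmod ((F z - G z) - (F (RtoC 0) - G (RtoC 0)))
     + K * (Cmod (F (RtoC 0)) * Cmod (schur_step G z)) * Cmod (F z - G z)
     + K * (Cmod (G z) * Cmod (schur_step G z)) * Cmod (F (RtoC 0) - G (RtoC 0)).
Proof.
  intros [_ BF] HG Ha Hb Hz Hr HK.
  pose proof (schur_step_bound G z HG Hb ltac:(red; lra)) as Bg1. destruct HG as [_ BG].
  specialize (BF z ltac:(red; lra)). specialize (BG z ltac:(red; lra)).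
  pose proof (mobius_denominator_neq0 _ _ Ha BF) as NF.
  pose proof (mobius_denominator_neq0 _ _ Hb BG) as NG.
  pose proof (mobius_denominator (F (RtoC 0)) _ BF) as DF.
  pose proof (schur_step_difference F G z NF NG) as E.
  set (a := F (RtoC 0)) in *. set (h0 := (a - G (RtoC 0))%C) in *.
  set (H := (F z - G z)%C) in *. set (g1 := schur_step G z) in *.
  set (H1 := (schur_step F z - g1)%C) in *.
  set (d := (1 - Cconj a * F z)%C) in *.
  assert (Hd : 0 < Cmod d) by now apply Cmod_gt_0.
  pose proof (Cmod_ge_0 a) as Pa.
  assert (HKd : 1 <= K * Cmod d).
  { assert (0 < K) by nra. apply Rle_trans with (K * (1 - Cmod a)); auto.
    apply Rmult_le_compat_l; lra. }
  (* A division-free form of [1 / |d| <= 1 + K |a| |F z|]. *)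
  assert (Hid : 1 <= (1 + K * (Cmod a * Cmod (F z))) * Cmod d).
  { assert (T : 1 <= Cmod d + Cmod a * Cmod (F z)).
    { rewrite <- Cmod_1. replace (RtoC 1) with (d + Cconj a * F z)%C by (unfold d; ring).
      eapply Rle_trans; [apply Cmod_triangle|]. rewrite Cmod_mult, Cmod_conj. lra. }
    assert (0 <= Cmod a * Cmod (F z)) by (apply Rmult_le_pos; auto using Cmod_ge_0).
    nra. }
  apply (Rmult_le_reg_r (Cmod d)); auto.
  assert (T : r * Cmod H1 * Cmod d <= Cmod (H - h0) + r * Cmod g1 * (Cmod a * Cmod H + Cmod h0 * Cmod (G z))).
  { rewrite <- Hz, <- !Cmod_mult, E.
    eapply Rle_trans; [apply Cmod_triangle|]. apply Rplus_le_compat_l.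
    rewrite Cmod_mult. apply Rmult_le_compat_l; [apply Cmod_ge_0|].
    eapply Rle_trans; [apply Cmod_triangle|].
    rewrite !Cmod_mult, !Cmod_conj. lra. }
  pose proof (Cmod_ge_0 (H - h0)) as P1. pose proof (Cmod_ge_0 H) as P2.
  pose proof (Cmod_ge_0 h0) as P3. pose proof (Cmod_ge_0 g1) as P4. pose proof (Cmod_ge_0 (G z)) as P5.
  set (S := Cmod g1 * (Cmod a * Cmod H + Cmod h0 * Cmod (G z))).
  assert (PS : 0 <= S) by (unfold S; repeat apply Rmult_le_pos || apply Rplus_le_le_0_compat; auto).
  assert (T1 : Cmod (H - h0) <= (1 + K * (Cmod a * Cmod (F z))) * Cmod d * Cmod (H - h0)) by nra.
  assert (T2 : r * S <= K * Cmod d * S) by nra.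
  unfold S in T2. nra.
Qed.

(** Cauchy-Schwarz with weights; used pointwise, it replaces the Minkowski
    inequality for the norm on the circle. *)
Lemma weighted_sq_le u v w x y z T :
  0 <= u -> 0 <= v -> 0 <= w -> 0 <= T -> T <= u * x + v * y + w * z ->
  T ^ 2 <= (u + v + w) * (u * x ^ 2 + v * y ^ 2 + w * z ^ 2).
Proof.
  intros Hu Hv Hw HT H.
  apply Rle_trans with ((u * x + v * y + w * z) ^ 2); [apply pow_incr; auto|].
  apply Rminus_le_0.
  replace ((u + v + w) * (u * x ^ 2 + v * y ^ 2 + w * z ^ 2) - (u * x + v * y + w * z) ^ 2)
    with (u * v * (x - y) ^ 2 + u * w * (x - z) ^ 2 + v * w * (y - z) ^ 2) by ring.
  repeat first [assumption | apply pow2_ge_0 | apply Rplus_le_le_0_compat | apply Rmult_le_pos].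
Qed.

(** All three functions on the right have mean square at most that of [F - G], by
    [mean_sq_center] and [center_le_mean_sq], so the weights just add up. *)
Lemma L2_norm_step F G H1 r w1 w2 w3 :
  smooth_on_disk F -> smooth_on_disk G -> smooth_on_disk H1 -> 0 < r < 1 ->
  0 <= w1 -> 0 <= w2 -> 0 <= w3 ->
  (forall t, let z := circle r t in
     r * Cmod (H1 z) <= w1 * Cmod ((F z - G z) - (F (RtoC 0) - G (RtoC 0)))
       + w2 * Cmod (F z - G z) + w3 * Cmod (F (RtoC 0) - G (RtoC 0))) ->
  r * L2_norm r H1 <= (w1 + w2 + w3) * L2_norm r (fun z => F z - G z)%C.
Proof.
  intros HF HG HH1 Hr Hw1 Hw2 Hw3 Hp.
  assert (HH : smooth_on_disk (fun z => F z - G z)%C) by now apply smooth_on_disk_sub.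
  assert (HH0 : smooth_on_disk (fun z => F z - G z - (F (RtoC 0) - G (RtoC 0)))%C)
    by (apply smooth_on_disk_sub; auto using smooth_on_disk_const).
  pose proof (continuous_circle_sq r _ HH1 Hr) as C1.
  pose proof (continuous_circle_sq r _ HH Hr) as C2.
  pose proof (continuous_circle_sq r _ HH0 Hr) as C3.
  pose proof (mean_sq_center _ r HH Hr) as E. cbv beta in E.
  pose proof (center_le_mean_sq _ r HH Hr) as Ec. cbv beta in Ec.
  rewrite !L2_norm_mean.
  set (h0 := (F (RtoC 0) - G (RtoC 0))%C) in *.
  set (M := mean r (fun z => Cmod (F z - G z) ^ 2)) in *.
  set (W := w1 + w2 + w3).
  assert (HW : 0 <= W) by (unfold W; lra).
  pose proof (pow2_ge_0 (Cmod h0)) as Ph.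
  assert (Key : r ^ 2 * mean r (fun z => Cmod (H1 z) ^ 2) <= W ^ 2 * M).
  { rewrite <- mean_scal by auto.
    assert (C4 : continuous_on_circle r (fun z => w2 * Cmod (F z - G z) ^ 2 + w3 * Cmod h0 ^ 2)).
    { apply continuous_circle_plus; [now apply continuous_circle_scal | apply continuous_circle_const]. }
    assert (C5 : continuous_on_circle r (fun z => w1 * Cmod (F z - G z - h0) ^ 2
        + (w2 * Cmod (F z - G z) ^ 2 + w3 * Cmod h0 ^ 2))).
    { apply continuous_circle_plus; [now apply continuous_circle_scal | exact C4]. }
    apply Rle_trans with (mean r (fun z => W * (w1 * Cmod (F z - G z - h0) ^ 2
        + (w2 * Cmod (F z - G z) ^ 2 + w3 * Cmod h0 ^ 2)))).
    - apply mean_le; [now apply continuous_circle_scal | now apply continuous_circle_scal |].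
      intros t. rewrite <- Rpow_mult_distr, <- Rplus_assoc.
      apply weighted_sq_le; [assumption.. | | apply Hp].
      apply Rmult_le_pos; [lra | apply Cmod_ge_0].
    - rewrite mean_scal by exact C5.
      rewrite mean_plus by (try exact C4; now apply continuous_circle_scal).
      rewrite mean_scal by exact C3.
      rewrite mean_plus by (apply continuous_circle_const || now apply continuous_circle_scal).
      rewrite mean_scal by exact C2. rewrite mean_const, E. fold M.
      replace (W ^ 2 * M) with (W * (W * M)) by ring.
      apply Rmult_le_compat_l; auto. unfold W.
      assert (w1 * Cmod h0 ^ 2 >= 0) by (apply Rle_ge, Rmult_le_pos; auto).
      assert (w3 * Cmod h0 ^ 2 <= w3 * M) by (apply Rmult_le_compat_l; auto).
      lra. }
  rewrite <- (sqrt_pow2 r) at 1 by lra. rewrite <- (sqrt_pow2 W) at 1 by lra.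
  rewrite <- !sqrt_mult_alt by apply pow2_ge_0.
  now apply sqrt_le_1_alt.
Qed.

Lemma schur_step_stability F G r K qF qG qG1 :
  schur_smooth F -> schur_smooth G ->
  Cmod (F (RtoC 0)) < 1 -> Cmod (G (RtoC 0)) < 1 ->
  0 < r < 1 -> 0 <= K -> 1 <= K * (1 - Cmod (F (RtoC 0))) ->
  (forall t, Cmod (F (circle r t)) ^ 2 <= qF) ->
  (forall t, Cmod (G (circle r t)) ^ 2 <= qG) ->
  (forall t, Cmod (schur_step G (circle r t)) ^ 2 <= qG1) ->
  r * L2_norm r (fun z => schur_step F z - schur_step G z)%C
  <= (1 + K * (Cmod (F (RtoC 0)) ^ 2 + qF / 2 + qG / 2 + qG1))
       * L2_norm r (fun z => F z - G z)%C.
Proof.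
  intros HF HG Ha Hb Hr HK0 HK BF BG BG1. set (a := Cmod (F (RtoC 0))) in *.
  assert (PF : 0 <= qF) by (eapply Rle_trans; [apply pow2_ge_0 | apply (BF 0)]).
  assert (PG : 0 <= qG) by (eapply Rle_trans; [apply pow2_ge_0 | apply (BG 0)]).
  assert (PG1 : 0 <= qG1) by (eapply Rle_trans; [apply pow2_ge_0 | apply (BG1 0)]).
  assert (Pa : 0 <= a ^ 2) by apply pow2_ge_0.
  replace (1 + K * (a ^ 2 + qF / 2 + qG / 2 + qG1))
    with ((1 + K * ((a ^ 2 + qF) / 2)) + K * ((a ^ 2 + qG1) / 2) + K * ((qG + qG1) / 2)) by field.
  assert (Pw : forall x y, 0 <= x -> 0 <= y -> 0 <= K * ((x + y) / 2))
    by (intros; apply Rmult_le_pos; lra).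
  apply L2_norm_step; auto.
  - apply HF.
  - apply HG.
  - apply smooth_on_disk_sub; now apply schur_step_smooth.
  - specialize (Pw (a ^ 2) qF Pa PF). lra.
  - intros t z.
    assert (Hz : Cmod z = r) by (unfold z; rewrite Cmod_circle, Rabs_pos_eq; lra).
    eapply Rle_trans; [apply (schur_step_pointwise F G z r K); auto|]. fold a.
    specialize (BF t). specialize (BG t). specialize (BG1 t). fold z in BF, BG, BG1.
    assert (AM : forall x y p q, x ^ 2 <= p -> y ^ 2 <= q -> K * (x * y) <= K * ((p + q) / 2)).
    { intros x y p q Hx Hy. apply Rmult_le_compat_l; auto. pose proof (pow2_ge_0 (x - y)). nra. }
    apply Rplus_le_compat; [apply Rplus_le_compat|];
      (apply Rmult_le_compat_r; [apply Cmod_ge_0|]).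
    + apply Rplus_le_compat_l. apply AM; auto. lra.
    + apply AM; auto. lra.
    + apply AM; auto.
Qed.

Lemma L2_norm_nonneg r F : 0 <= L2_norm r F.
Proof. apply sqrt_pos. Qed.

Lemma sum_lt_shift f n : sum_lt (fun k => f (S k)) n + f 0%nat = sum_lt f (S n).
Proof. induction n as [|n IH]; [simpl; ring|]. cbn [sum_lt] in *. lra. Qed.

Theorem theorem1p2 :
  forall (F G : C -> C) (eta : R),
    szego_class F -> szego_class G ->
    0 < eta -> eta <= Rmin (schur_eta F) (schur_eta G) ->
    forall (r : R) (n : nat), 0 < r < 1 ->
      L2_norm r (fun z => schur_iter F n z - schur_iter G n z)%C
      <= stability_const eta r * / r ^ n * L2_norm r (fun z => F z - G z)%C.
Proof.
  intros F G eta [[SF _] EF] [[SG _] EG] H0 Heta r n Hr.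
  apply schur_class_smooth in SF. apply schur_class_smooth in SG.
  pose proof (Rmin_l (schur_eta F) (schur_eta G)).
  pose proof (Rmin_r (schur_eta F) (schur_eta G)).
  pose proof (schur_iter_smooth F SF EF) as IF.
  pose proof (schur_iter_smooth G SG EG) as IG.
  destruct (schur_parameters_bounds F eta SF H0 ltac:(lra)) as (AF & LF & E1).
  destruct (schur_parameters_bounds G eta SG H0 ltac:(lra)) as (_ & LG & _).
  set (a := fun k => Cmod (schur_iter F k (RtoC 0))) in *.
  set (b := fun k => Cmod (schur_iter G k (RtoC 0))) in *.
  assert (Ha : forall k, 0 <= a k <= 1) by (intros k; split; [apply Cmod_ge_0 | apply Rlt_le, IF]).
  assert (Hb : forall k, 0 <= b k <= 1) by (intros k; split; [apply Cmod_ge_0 | apply Rlt_le, IG]).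
  set (A := ln (/ eta)) in *.
  assert (PA : 0 <= A) by (specialize (LF 0%nat); exact LF).
  assert (Hs : 0 <= sqrt (1 - eta) < 1).
  { split; [apply sqrt_pos|]. rewrite <- sqrt_1 at 2. apply sqrt_lt_1_alt. lra. }
  set (K := 1 / (1 - sqrt (1 - eta))).
  assert (HK : 0 < K) by (apply Rdiv_lt_0_compat; lra).
  assert (HKa : forall k, 1 <= K * (1 - a k)).
  { intros k. apply Rle_trans with (K * (1 - sqrt (1 - eta))).
    - unfold K. right. field. lra.
    - apply Rmult_le_compat_l; [lra|]. specialize (AF k). fold (a k) in AF. lra. }
  set (qF := tail_majorant r a). set (qG := tail_majorant r b).
  set (eps := fun k => K * (a k ^ 2 + qF k / 2 + qG k / 2 + qG (S k))).
  set (N := fun k => L2_norm r (fun z => schur_iter F k z - schur_iter G k z)%C).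
  assert (Step : forall k, r * N (S k) <= (1 + eps k) * N k).
  { intros k. apply (schur_step_stability (schur_iter F k) (schur_iter G k));
      try apply IF; try apply IG; auto; try lra.
    - apply HKa.
    - intros t. now apply schur_iter_majorant.
    - intros t. now apply schur_iter_majorant.
    - intros t. now apply (schur_iter_majorant G r (S k)). }
  assert (Iter : forall k, r ^ k * N k <= exp (sum_lt eps k) * N 0%nat).
  { induction k as [|k IH].
    - cbn [sum_lt]. rewrite exp_0. simpl. lra.
    - cbn [sum_lt]. rewrite exp_plus. specialize (Step k).
      pose proof (exp_ineq1_le (eps k)) as He.
      pose proof (L2_norm_nonneg r (fun z => schur_iter F k z - schur_iter G k z)%C) as PN.
      fold (N k) in PN. pose proof (pow_lt r k (proj1 Hr)) as Pr.
      apply Rle_trans with (r ^ k * (exp (eps k) * N k)).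
      + replace (r ^ S k * N (S k)) with (r ^ k * (r * N (S k))) by (simpl; ring).
        apply Rmult_le_compat_l; [lra|]. eapply Rle_trans; [exact Step|].
        apply Rmult_le_compat_r; auto.
      + replace (r ^ k * (exp (eps k) * N k)) with (exp (eps k) * (r ^ k * N k)) by ring.
        replace (exp (sum_lt eps k) * exp (eps k) * N 0%nat)
          with (exp (eps k) * (exp (sum_lt eps k) * N 0%nat)) by ring.
        apply Rmult_le_compat_l; auto. apply Rlt_le, exp_pos. }
  assert (Sum : sum_lt eps n <= K * (A + 2 * (A / (1 - r) ^ 2))).
  { assert (Split : sum_lt eps n = K * (sum_lt (fun k => a k ^ 2) n + sum_lt qF n / 2
         + sum_lt qG n / 2 + sum_lt (fun k => qG (S k)) n)).
    { clear. induction n as [|n IH]; cbn [sum_lt]; [field|]. rewrite IH. unfold eps. field. }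
    rewrite Split. apply Rmult_le_compat_l; [lra|].
    pose proof (tail_majorant_sum r a A n Hr Ha LF) as B1. fold qF in B1.
    pose proof (tail_majorant_sum r b A n Hr Hb LG) as B2. fold qG in B2.
    pose proof (tail_majorant_sum r b A (S n) Hr Hb LG) as B3. fold qG in B3.
    rewrite <- sum_lt_shift in B3.
    pose proof (tail_majorant_nonneg r b 0 Hr Hb) as P. fold qG in P.
    specialize (LF n). change (sum_lt (fun k => a k ^ 2) n <= A) in LF. lra. }
  assert (Exp : exp (sum_lt eps n) <= stability_const eta r).
  { unfold stability_const. fold A. fold K.
    assert (Hexp : sum_lt eps n <= A * (2 + K) * (4 / (1 - r) ^ 2 + 1)).
    { eapply Rle_trans; [exact Sum|].
      assert (Pi : 0 <= / (1 - r) ^ 2) by (apply Rlt_le, Rinv_0_lt_compat, pow_lt; lra).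
      set (i := / (1 - r) ^ 2) in *. unfold Rdiv. fold i.
      assert (0 <= A * i) by (apply Rmult_le_pos; auto).
      assert (0 <= K * (A * i)) by (apply Rmult_le_pos; lra).
      nra. }
    destruct Hexp as [Hlt | ->]; [apply Rlt_le, exp_increasing, Hlt | apply Rle_refl]. }
  pose proof (pow_lt r n (proj1 Hr)) as Pr.
  apply (Rmult_le_reg_l (r ^ n)); auto.
  replace (r ^ n * (stability_const eta r * / r ^ n * L2_norm r (fun z => F z - G z)%C))
    with (stability_const eta r * L2_norm r (fun z => F z - G z)%C) by (field; lra).
  eapply Rle_trans; [apply Iter|].
  apply Rmult_le_compat_r; [apply L2_norm_nonneg | exact Exp].
Qed.
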